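(* Let $K$ be an algebraically closed field of characteristic zero. Let $c(x)\in K[x]$ be a polynomial of degree $n\geq 2$ and let $q(x,y)\in K[x,y]$ be a quasi-monic polynomial of degree $d\geq 2$ with respect to $y$. Assume that the $K$-algebra $A_{c,q}=K[x,y,z]/\big(c(x)z-q(x,y)\big)$ is in reduced form. Let $\psi:\mathrm{Aut}_K(A_{c,q})\to \mathbb{T}_2$ and $\varphi:\mathbb{G}_{c,q}\to\mathrm{Aut}_K(A_{c,q})$ be the canonical homomorphisms. Then $\mathrm{Im}(\psi)=\mathbb{G}_{c,q}$ and $\psi\varphi=\mathrm{id}_{\mathbb{G}_{c,q}}$. As a consequence, the short exact sequence $$1\longrightarrow \mathbb{U}_K(A_{c,q})\longrightarrow \mathrm{Aut}_K(A_{c,q})\stackrel{\psi}{\longrightarrow}\mathrm{Im}(\psi)\longrightarrow 1$$ is split, and hence the group $\mathrm{Aut}_K(A_{c,q})$ is the inner semidirect product of $\mathbb{U}_K(A_{c,q})$ and $\mathrm{Im}(\varphi)$.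
   Context: $K$ is an algebraically closed field of characteristic zero and $K^{\star}=K\setminus\{0\}$. A polynomial $q(x,y)\in K[x,y]$ is quasi-monic with respect to $y$ if its leading coefficient with respect to $y$ is a constant in $K^{\star}$. Write $A_{c,q}=K[\bar x,\bar y,\bar z]$, where $\bar x,\bar y,\bar z$ are the classes of $x,y,z$ (it is an integral domain, and $\bar x,\bar y$ are algebraically independent over $K$). A quasi-monic polynomial $p(y)\in R[y]$ of degree $d\geq 1$ (leading coefficient a nonzero constant) is centered if its coefficient of degree $d-1$ is zero. The algebra $A_{c,q}$ is in reduced form if $c(x)$ is centered, $q(x,y)$ is centered as a polynomial in $y$ over $K[x]$, and $\deg_x(q)<\deg(c)$. $\mathrm{Aut}_K(A_{c,q})$ is the group of $K$-algebra automorphisms. A $K$-derivation $\delta$ of $A_{c,q}$ is locally nilpotent if for every $a$ there is $k\ge 1$ with $\delta^k(a)=0$; then $\exp(\delta)=\sum_{k\ge 0}\delta^k/k!$ is a $K$-automorphism. $\mathbb{U}_K(A_{c,q})$ is the subgroup of $\mathrm{Aut}_K(A_{c,q})$ generated by all $\exp(\delta)$ with $\delta$ a locally nilpotent $K$-derivation of $A_{c,q}$. $\mathbb{T}_2=K^{\star}\times K^{\star}$ is the two-dimensional algebraic torus. Canonical homomorphism $\psi$: for every $\sigma\in\mathrm{Aut}_K(A_{c,q})$ there exist unique $(e_\sigma,a_\sigma)\in K^{\star}\times K$ and $(u_\sigma,h_\sigma)\in K^{\star}\times K[x]$ with $\sigma(\bar x)=e_\sigma\bar x+a_\sigma$ and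 $\sigma(\bar y)=u_\sigma\bar y+h_\sigma(\bar x)$; one sets $\psi(\sigma)=(e_\sigma,u_\sigma)$. This is a group homomorphism with kernel $\mathbb{U}_K(A_{c,q})$. $\mathbb{G}_{c,q}=\{(e,u)\in\mathbb{T}_2\mid c(ex)=e^nc(x),\ q(ex,uy)=u^dq(x,y)\}$, an algebraic subgroup of $\mathbb{T}_2$. Canonical homomorphism $\varphi$: for $(e,u)\in\mathbb{G}_{c,q}$, $\varphi(e,u)=\varphi_{e,u}$ is the $K$-automorphism of $A_{c,q}$ given by $\bar x\mapsto e\bar x$, $\bar y\mapsto u\bar y$, $\bar z\mapsto e^{-n}u^d\bar z$. *)

(* Defs.v *)
From HB Require Import structures.
From mathcomp Require Import all_boot all_order all_algebra ring_quotient.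
From mathcomp Require Import boolp classical_sets.
From mathcomp Require Import mpoly.

Set Implicit Arguments.
Unset Strict Implicit.
Unset Printing Implicit Defensive.

Import GRing.Theory.
Local Open Scope ring_scope.
Local Open Scope quotient_scope.
Local Open Scope classical_set_scope.

Section Groups.

Variable G : groupType.
Local Open Scope group_scope.

Definition subgroup (H : set G) : Prop := group_closed [pred x in H].

Definition generated (S : set G) : set G := smallest subgroup S.

Definition normal_subgroup (N : set G) : Prop :=
  subgroup N /\ forall g x : G, N x -> N (x ^ g).

Definition inner_semidirect (N H : set G) : Prop :=
  [/\ normal_subgroup N, subgroup H, N `&` H = [set 1]
    & forall g : G, exists2 x, N x & exists2 h, H h & g = x * h].

Definition group_hom (H : groupType) (f : G -> H) : Prop :=
  {morph f : x y / x * y}.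

(* The sequence 1 -> N -> G -> range f -> 1, with first map the inclusion of   *)
(* N and second map f; only exactness at G has content.                        *)
Definition short_exact (H : groupType) (N : set G) (f : G -> H) : Prop :=
  [/\ subgroup N, group_hom f & f @^-1` [set 1] = N].

(* The values of the section s outside range f are irrelevant.                 *)
Definition splits (H : groupType) (f : G -> H) : Prop :=
  exists s : H -> G,
    {in range f &, {morph s : x y / x * y}} /\ {in range f, cancel s f}.

End Groups.

Section MultiplicativeGroup.

Variable K : fieldType.

Definition Kstar : Type := {x : K | x != 0}.
HB.instance Definition _ := Choice.on Kstar.

Fact Kstar_mul_subproof (x y : Kstar) : val x * val y != 0.
Proof. by rewrite mulf_neq0 // ?(valP x) ?(valP y). Qed.
Fact Kstar_inv_subproof (x : Kstar) : (val x)^-1 != 0.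
Proof. by rewrite invr_eq0 (valP x). Qed.

Definition Kstar_one : Kstar := Sub 1 (oner_neq0 K).
Definition Kstar_mul (x y : Kstar) : Kstar :=
  Sub (val x * val y) (Kstar_mul_subproof x y).
Definition Kstar_inv (x : Kstar) : Kstar :=
  Sub (val x)^-1 (Kstar_inv_subproof x).

Fact Kstar_mulA : associative Kstar_mul.
Proof. by move=> x y z; apply: val_inj; rewrite /= mulrA. Qed.
Fact Kstar_mul1 : left_id Kstar_one Kstar_mul.
Proof. by move=> x; apply: val_inj; rewrite /= mul1r. Qed.
Fact Kstar_mulr1 : right_id Kstar_one Kstar_mul.
Proof. by move=> x; apply: val_inj; rewrite /= mulr1. Qed.
Fact Kstar_mulV : left_inverse Kstar_one Kstar_inv Kstar_mul.
Proof. by move=> x; apply: val_inj; rewrite /= mulVf ?(valP x). Qed.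
Fact Kstar_mulrV : right_inverse Kstar_one Kstar_inv Kstar_mul.
Proof. by move=> x; apply: val_inj; rewrite /= mulfV ?(valP x). Qed.

HB.instance Definition _ := isGroup.Build Kstar
  Kstar_mulA Kstar_mul1 Kstar_mulr1 Kstar_mulV Kstar_mulrV.

End MultiplicativeGroup.

Definition torus2 (K : fieldType) : Type := (Kstar K * Kstar K)%type.
HB.instance Definition _ (K : fieldType) := Group.on (torus2 K).

Section Automorphisms.

Variables (K : fieldType) (A : algType K).

Record algAut := AlgAut {
  algAut_fun :> {lrmorphism A -> A};
  algAut_bij : bijective algAut_fun }.

HB.instance Definition _ := gen_eqMixin algAut.
HB.instance Definition _ := gen_choiceMixin algAut.

Lemma algAutP (s t : algAut) : s =1 t -> s = t.
Proof.
case: s t => [[f cf] bf] [[g cg] bg] /= /funext efg.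
move: efg cf bf cg bg; rewrite /= => -> cf bf cg bg.
have ec : cf = cg.
  case: cf {bf} => [[a] [b] [d]]; case: cg {bg} => [[a'] [b'] [d']].
  by rewrite (Prop_irrelevance a a') (Prop_irrelevance b b')
             (Prop_irrelevance d d').
by move: bf bg; rewrite ec => bf bg; rewrite (Prop_irrelevance bf bg).
Qed.

Fact algAut_one_bij : bijective (idfun : {lrmorphism A -> A}).
Proof. by exists idfun. Qed.
Definition algAut_one : algAut := AlgAut algAut_one_bij.

Fact algAut_mul_bij (s t : algAut) : bijective (s \o t : {lrmorphism A -> A}).
Proof. exact: bij_comp (algAut_bij s) (algAut_bij t). Qed.
(* (s * t)%g is s after t.                                                     *)
Definition algAut_mul (s t : algAut) : algAut := AlgAut (algAut_mul_bij s t).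

Section Inverse.
Variable s : algAut.

Fact algAut_inv_ex : exists g : A -> A, cancel s g /\ cancel g s.
Proof. by case: (algAut_bij s) => g sK gK; exists g. Qed.
Definition algAut_inv_fun : A -> A := projT1 (cid algAut_inv_ex).
Fact algAut_funK : cancel s algAut_inv_fun.
Proof. by rewrite /algAut_inv_fun; case: cid => g []. Qed.
Fact algAut_inv_funK : cancel algAut_inv_fun s.
Proof. by rewrite /algAut_inv_fun; case: cid => g []. Qed.

HB.instance Definition _ := GRing.isZmodMorphism.Build A A algAut_inv_fun
  (can2_zmod_morphism algAut_funK algAut_inv_funK).
HB.instance Definition _ := GRing.isMonoidMorphism.Build A A algAut_inv_fun
  (can2_monoid_morphism algAut_funK algAut_inv_funK).
HB.instance Definition _ := GRing.isScalable.Build K A A *:%R algAut_inv_fun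
  (can2_scalable algAut_funK algAut_inv_funK).

Fact algAut_inv_bij : bijective (algAut_inv_fun : {lrmorphism A -> A}).
Proof. by exists s; [exact: algAut_inv_funK|exact: algAut_funK]. Qed.
Definition algAut_inv : algAut := AlgAut algAut_inv_bij.
End Inverse.

Fact algAut_mulA : associative algAut_mul.
Proof. by move=> s t u; apply: algAutP. Qed.
Fact algAut_mul1 : left_id algAut_one algAut_mul.
Proof. by move=> s; apply: algAutP. Qed.
Fact algAut_mulr1 : right_id algAut_one algAut_mul.
Proof. by move=> s; apply: algAutP. Qed.
Fact algAut_mulV : left_inverse algAut_one algAut_inv algAut_mul.
Proof. by move=> s; apply: algAutP => a /=; rewrite algAut_funK. Qed.
Fact algAut_mulrV : right_inverse algAut_one algAut_inv algAut_mul.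
Proof. by move=> s; apply: algAutP => a /=; rewrite algAut_inv_funK. Qed.

HB.instance Definition _ := isGroup.Build algAut
  algAut_mulA algAut_mul1 algAut_mulr1 algAut_mulV algAut_mulrV.

Definition derivation (delta : {linear A -> A}) : Prop :=
  forall a b : A, delta (a * b) = delta a * b + a * delta b.

Definition locally_nilpotent (delta : {linear A -> A}) : Prop :=
  forall a : A, exists2 k : nat, (0 < k)%N & iter k delta a = 0.

(* For a locally nilpotent delta, s = exp delta: the series at a stops at any  *)
(* k with delta^k a = 0.                                                       *)
Definition is_exp (delta : {linear A -> A}) (s : algAut) : Prop :=
  forall (a : A) (k : nat), iter k delta a = 0 ->
    s a = \sum_(i < k) (i`!%:R^-1 : K) *: iter i delta a.

Definition unipotent_subgroup : set algAut :=
  generated [set s | exists delta : {linear A -> A},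
    [/\ derivation delta, locally_nilpotent delta & is_exp delta s]].

End Automorphisms.

Arguments unipotent_subgroup {K} A.

(* Bivariate polynomials q(x, y) are elements of {poly {poly K}} = K[x][y]:    *)
(* the inner variable is x and the outer one is y.                             *)

Section ReducedForm.

Variable K : fieldType.

Definition deg (R : nzRingType) (p : {poly R}) : nat := (size p).-1.

Definition deg_x (q : {poly {poly K}}) : nat := (sizeY q).-1.

Definition quasi_monic (R : algType K) (p : {poly R}) : Prop :=
  exists2 k : K, k != 0 & lead_coef p = k%:A.

Definition centered (R : algType K) (p : {poly R}) : Prop :=
  [/\ (1 <= deg p)%N, quasi_monic p & p`_(deg p).-1 = 0].

Definition reduced_form (c : {poly K}) (q : {poly {poly K}}) : Prop :=
  [/\ @centered K^o c, centered q & (deg_x q < deg c)%N].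

Definition eval_xy (B : comAlgType K) (q : {poly {poly K}}) (a b : B) : B :=
  (map_poly (horner_alg a) q).[b].

End ReducedForm.

Lemma coef_scaleX (R : comNzRingType) (p : {poly R}) (a : R) i :
  (p \Po (a *: 'X))`_i = a ^+ i * p`_i.
Proof.
rewrite comp_polyE coef_sum.
transitivity (\sum_(j < size p | j == i :> nat) a ^+ i * p`_i).
  rewrite [RHS]big_mkcond; apply: eq_bigr => j _.
  rewrite exprZn scalerA coefZ coefXn eq_sym.
  by case: eqP => [->|]; rewrite ?mulr0 // mulr1 mulrC.
have [lt_ip|le_pi] := ltnP i (size p).
  by rewrite (big_pred1 (Ordinal lt_ip)).
rewrite big_pred0 ?(nth_default _ le_pi) ?mulr0 // => j.
by apply: contraTF (ltn_ord j) => /eqP->; rewrite -leqNgt.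
Qed.

Section Surface.

Variables (K : closedFieldType) (c : {poly K}) (q : {poly {poly K}}).

Definition relator : {mpoly K[3]} :=
  horner_alg 'X_0 c * 'X_2 - eval_xy q 'X_0 'X_1.

Definition eval_xyz (B : comAlgType K) (v : 'I_3 -> B) : {mpoly K[3]} -> B :=
  mmap (in_alg B) v.

HB.instance Definition _ B v := GRing.RMorphism.on (@eval_xyz B v).

Lemma eval_xyz_alg (B : comAlgType K) (v : 'I_3 -> B) (k : K) :
  eval_xyz v k%:A = k%:A.
Proof. by rewrite /eval_xyz -mul_mpolyC mulr1 mmapC. Qed.

Lemma eval_xyzX (B : comAlgType K) (v : 'I_3 -> B) i : eval_xyz v 'X_i = v i.
Proof. by rewrite /eval_xyz mmapX mmap1U. Qed.

Lemma eval_xyz_horner (B : comAlgType K) (v : 'I_3 -> B) (p : {poly K}) i :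
  eval_xyz v (horner_alg 'X_i p) = horner_alg (v i) p.
Proof.
elim/poly_ind: p => [|p k IHp]; first by rewrite !rmorph0.
rewrite !(rmorphD, rmorphM) /= !horner_algX !horner_algC eval_xyz_alg IHp.
by congr (_ * _ + _); apply: eval_xyzX.
Qed.

Lemma eval_xyz_relator (B : comAlgType K) (v : 'I_3 -> B) :
  eval_xyz v relator = horner_alg (v 0) c * v 2 - eval_xy q (v 0) (v 1).
Proof.
rewrite rmorphB rmorphM /= eval_xyz_horner eval_xyzX /eval_xy.
congr (_ - _); rewrite -horner_map -map_poly_comp; congr (_.[_]).
  by apply: eq_map_poly => p /=; apply: eval_xyz_horner.
exact: eval_xyzX.
Qed.

(* c != 0 makes the ideal (relator) proper, as idealr and algType require      *)
(* nontrivial rings.                                                           *)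
Hypothesis c_neq0 : c != 0.

Definition rel_ideal (_ : c != 0) : {pred {mpoly K[3]}} :=
  fun f => `[< exists g, f = g * relator >].

Fact rel_ideal_closed : idealr_closed (rel_ideal c_neq0).
Proof.
split.
- by apply/asboolP; exists 0; rewrite mul0r.
- apply/asboolP => -[g g1]; have [a ca] := closed_nonrootP c c_neq0.
  pose b : K := q.[0].[a]; pose v (i : 'I_3) : K^o := [:: a; 0; b / c.[a]]`_i.
  have hornerE_ (p : {poly K}) (x : K) : horner_alg (x : K^o) p = p.[x].
    elim/poly_ind: p => [|p k IHp]; first by rewrite rmorph0 horner0.
    by rewrite rmorphD rmorphM /= horner_algX horner_algC IHp hornerMXaddC
               -[k%:A]/(k * 1) mulr1.
  have v_rel : eval_xyz v relator = 0.
    rewrite eval_xyz_relator hornerE_ /v /= mulrC divfK // /eval_xy.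
    rewrite horner_coef0 coef_map /= hornerE_ /b horner_coef0.
    exact: subrr.
  have := congr1 (@eval_xyz K^o v) g1; rewrite rmorph1 rmorphM /= v_rel mulr0.
  by move/eqP; rewrite oner_eq0.
- move=> a f g /asboolP[f' ->] /asboolP[g' ->]; apply/asboolP.
  by exists (a * f' + g'); rewrite mulrDl mulrA.
Qed.

HB.instance Definition _ := isIdealr.Build {mpoly K[3]} (rel_ideal c_neq0)
  rel_ideal_closed.

Definition surface : Type := {ideal_quot (rel_ideal c_neq0)}.

HB.instance Definition _ := GRing.ComNzRing.on surface.

Definition surface_pi : {mpoly K[3]} -> surface := \pi_surface.
HB.instance Definition _ := GRing.RMorphism.copy surface_pi \pi_surface.

Definition surface_scale (k : K) (a : surface) : surface :=
  surface_pi k%:A * a.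

Fact surface_scaleA k l a :
  surface_scale k (surface_scale l a) = surface_scale (k * l) a.
Proof.
by rewrite /surface_scale mulrA -rmorphM /= -scalerAl mul1r scalerA.
Qed.
Fact surface_scale1 : left_id 1 surface_scale.
Proof. by move=> a; rewrite /surface_scale scale1r rmorph1 mul1r. Qed.
Fact surface_scaleDr : right_distributive surface_scale +%R.
Proof. by move=> k a b; rewrite /surface_scale mulrDr. Qed.
Fact surface_scaleDl a : {morph surface_scale^~ a : k l / k + l}.
Proof. by move=> k l; rewrite /surface_scale scalerDl rmorphD mulrDl. Qed.

HB.instance Definition _ := GRing.Zmodule_isLmodule.Build K surface
  surface_scaleA surface_scale1 surface_scaleDr surface_scaleDl.

Fact surface_scaleAl k (a b : surface) : k *: (a * b) = (k *: a) * b.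
Proof. exact: mulrA. Qed.

HB.instance Definition _ := GRing.Lmodule_isLalgebra.Build K surface
  surface_scaleAl.
HB.instance Definition _ := GRing.Lalgebra_isComAlgebra.Build K surface.

Fact surface_pi_scalable : scalable surface_pi.
Proof.
by move=> k p; rewrite -[k *: p]mulr_algl rmorphM.
Qed.
HB.instance Definition _ := GRing.isScalable.Build K {mpoly K[3]} surface *:%R
  surface_pi surface_pi_scalable.

Definition xbar : surface := surface_pi 'X_0.
Definition ybar : surface := surface_pi 'X_1.
Definition zbar : surface := surface_pi 'X_2.

Definition coord (i : 'I_3) : surface := [:: xbar; ybar; zbar]`_i.

Lemma surface_piE f : surface_pi f = eval_xyz coord f.
Proof.
have piX (i : 'I_3) : surface_pi 'X_i = coord i.
  by case: i => -[|[|[|//]]] lti; rewrite /coord /=;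
     congr (surface_pi 'X_ _); apply: val_inj.
elim/mpolyind: f => [|k m f _ _ IHf]; first by rewrite !rmorph0.
rewrite !rmorphD /= IHf; congr (_ + _).
rewrite linearZ -[k *: 'X_[m]]mulr_algl rmorphM /= eval_xyz_alg mulr_algl.
congr (_ *: _); rewrite mpolyXE_id !rmorph_prod.
apply: eq_bigr => i _.
by rewrite !rmorphXn /=; congr (_ ^+ _); rewrite [RHS]eval_xyzX -piX.
Qed.

Lemma surface_pi_relator : surface_pi relator = 0.
Proof.
rewrite -(rmorph0 surface_pi); apply/eqP; rewrite -Quotient.idealrBE subr0.
by apply/asboolP; exists 1; rewrite mul1r.
Qed.

Lemma surface_eq : horner_alg xbar c * zbar - eval_xy q xbar ybar = 0.
Proof. by rewrite -surface_pi_relator surface_piE eval_xyz_relator. Qed.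

(* (e, u) with s x = e x + a and s y = u y + h(x) for some a and h; the value  *)
(* 1 is a default for an s of another form.                                    *)
Definition psi (s : algAut surface) : torus2 K :=
  xget 1%g [set eu : torus2 K | exists (a : K) (h : {poly K}),
    s xbar = val eu.1 *: xbar + a%:A /\
    s ybar = val eu.2 *: ybar + horner_alg xbar h].

(* c(e x) = e^n c(x) and q(e x, u y) = u^d q(x, y), n = deg c, d = deg_y q    *)
Definition G_cq : set (torus2 K) :=
  [set eu | c \Po (val eu.1 *: 'X) = val eu.1 ^+ deg c *: c /\
    map_poly (fun p => p \Po (val eu.1 *: 'X)) q \Po ((val eu.2)%:P *: 'X)
      = (val eu.2 ^+ deg q)%:P *: q].

Lemma G_cqP (eu : torus2 K) : G_cq eu <->
  (forall i, c`_i != 0 -> val eu.1 ^+ i = val eu.1 ^+ deg c) /\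
  (forall j i, q`_j`_i != 0 ->
     val eu.1 ^+ i * val eu.2 ^+ j = val eu.2 ^+ deg q).
Proof.
case: eu => -[e e0] [u u0]; rewrite /G_cq /=; split=> -[ec eq_]; split.
- move=> i ci; apply: (mulIf ci); move/polyP/(_ i): ec.
  by rewrite coef_scaleX coefZ.
- move=> j i qji; apply: (mulIf qji).
  move/polyP/(_ j)/polyP/(_ i): eq_; rewrite coef_scaleX coef_map_id0 ?comp_poly0 //.
  rewrite -polyC_exp !coefCM coef_scaleX mulrA [u ^+ j * _]mulrC => ->.
  by rewrite coefZ coefCM.
- apply/polyP => i; rewrite coef_scaleX coefZ.
  by have [->|/ec->] := eqVneq c`_i 0; rewrite ?mulr0.
- apply/polyP => j; apply/polyP => i.
  rewrite coef_scaleX coef_map_id0 ?comp_poly0 // coefZ.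
  rewrite -polyC_exp !coefCM coef_scaleX mulrA [u ^+ j * _]mulrC.
  by have [->|/eq_->] := eqVneq q`_j`_i 0; rewrite ?mulr0.
Qed.

Fact G_cq_group_closed : group_closed [pred eu in G_cq].
Proof.
split=> [|[e u] [f v]].
  by apply/mem_set/G_cqP; split=> *; rewrite /= !expr1n ?mulr1.
move=> /set_mem/G_cqP[/= ec eq_] /set_mem/G_cqP[/= fc fq].
apply/mem_set/G_cqP; split=> /= [i ci|j i qji]; rewrite !exprMn !exprVn.
  by rewrite ec // fc.
by rewrite mulrACA eq_ // -invfM fq.
Qed.

Definition Gcq : Type := {eu : torus2 K | eu \in [pred eu in G_cq]}.
HB.instance Definition _ := SubChoice.on Gcq.
HB.instance Definition _ := SubChoice_isSubGroup.Build (torus2 K)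
  [pred eu in G_cq] Gcq G_cq_group_closed.

Lemma horner_alg_scale (B : comAlgType K) (a : B) k (p : {poly K}) :
  horner_alg (k *: a) p = horner_alg a (p \Po (k *: 'X)).
Proof.
elim/poly_ind: p => [|p l IHp]; first by rewrite comp_poly0 !rmorph0.
rewrite comp_polyD comp_polyM comp_polyX comp_polyC !(rmorphD, rmorphM) /=.
rewrite !horner_algX !horner_algC IHp; congr (_ * _ + _).
by rewrite -mul_polyC rmorphM /= horner_algC horner_algX mulr_algl.
Qed.

Lemma eval_xy_scale (B : comAlgType K) (a b : B) e u :
  eval_xy q (e *: a) (u *: b) =
  eval_xy (map_poly (fun p => p \Po (e *: 'X)) q \Po (u%:P *: 'X)) a b.
Proof.
rewrite /eval_xy map_comp_poly horner_comp; congr (_.[_]); last first.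
  by rewrite map_polyZ map_polyX hornerZ hornerX /= horner_algC mulr_algl.
apply/polyP => j; rewrite !coef_map /=.
exact: horner_alg_scale.
Qed.

Definition phi_coord (eu : torus2 K) (i : 'I_3) : surface :=
  [:: val eu.1 *: xbar; val eu.2 *: ybar;
      (val eu.1 ^- deg c * val eu.2 ^+ deg q) *: zbar]`_i.

Lemma phi_relator (g : Gcq) : eval_xyz (phi_coord (val g)) relator = 0.
Proof.
case: g => -[[e e0] [u u0]] /= /set_mem[/= ec eq_].
rewrite eval_xyz_relator /phi_coord /= horner_alg_scale eval_xy_scale ec eq_.
rewrite linearZ /= mulr_algl -scalerAr -scalerAl scalerA mulrAC mulVf ?expf_neq0 // mul1r.
rewrite [X in _ - X]/eval_xy map_polyZ hornerZ /= horner_algC mulr_algl.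
rewrite -scalerBr -[X in _ *: X]/(_ - eval_xy q xbar ybar) surface_eq.
exact: scaler0.
Qed.

Definition phi_fun (g : Gcq) (a : surface) : surface :=
  eval_xyz (phi_coord (val g)) (repr a).

Lemma phi_pi g f :
  phi_fun g (surface_pi f) = eval_xyz (phi_coord (val g)) f.
Proof.
apply/eqP; rewrite -subr_eq0 -rmorphB.
have : repr (surface_pi f) - f \in rel_ideal c_neq0.
  by rewrite Quotient.idealrBE reprK.
by case/asboolP => h ->; rewrite rmorphM /= phi_relator mulr0.
Qed.

Fact phi_zmod_morphism g : zmod_morphism (phi_fun g).
Proof.
move=> a b; rewrite -[a]reprK -[b]reprK -!/(surface_pi _) -rmorphB !phi_pi.
exact: rmorphB.
Qed.
Fact phi_monoid_morphism g : monoid_morphism (phi_fun g).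
Proof.
split=> [|a b].
  by rewrite -(rmorph1 surface_pi) phi_pi [LHS]rmorph1 rmorph1.
rewrite -[a]reprK -[b]reprK -!/(surface_pi _) -rmorphM !phi_pi.
exact: rmorphM.
Qed.
Fact phi_scalable g : scalable (phi_fun g).
Proof.
move=> k a; rewrite -[a]reprK -!/(surface_pi _) -linearZ !phi_pi.
by rewrite -mulr_algl rmorphM /= eval_xyz_alg mulr_algl.
Qed.

HB.instance Definition _ g := GRing.isZmodMorphism.Build surface surface
  (phi_fun g) (phi_zmod_morphism g).
HB.instance Definition _ g := GRing.isMonoidMorphism.Build surface surface
  (phi_fun g) (phi_monoid_morphism g).
HB.instance Definition _ g := GRing.isScalable.Build K surface surface *:%R
  (phi_fun g) (phi_scalable g).

Lemma phi_x g : phi_fun g xbar = val (val g).1 *: xbar.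
Proof. by rewrite phi_pi eval_xyzX. Qed.
Lemma phi_y g : phi_fun g ybar = val (val g).2 *: ybar.
Proof. by rewrite phi_pi eval_xyzX. Qed.
Lemma phi_z g : phi_fun g zbar =
  (val (val g).1 ^- deg c * val (val g).2 ^+ deg q) *: zbar.
Proof. by rewrite phi_pi eval_xyzX. Qed.

Lemma surface_morph_eq (f g : {lrmorphism surface -> surface}) :
  f xbar = g xbar -> f ybar = g ybar -> f zbar = g zbar -> f =1 g.
Proof.
move=> fx fy fz a; rewrite -[a]reprK -!/(surface_pi _) surface_piE.
have fgi i : f (coord i) = g (coord i) by case: i => -[|[|[|//]]].
elim/mpolyind: (repr a) => [|k m p _ _ IHp]; first by rewrite !rmorph0.
rewrite !rmorphD /= IHp; congr (_ + _).
rewrite -[k *: 'X_[m]]mulr_algl rmorphM /= eval_xyz_alg mulr_algl !linearZ /=.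
congr (_ *: _); rewrite mpolyXE_id !rmorph_prod; apply: eq_bigr => i _.
by rewrite !rmorphXn /=; congr (_ ^+ _); rewrite eval_xyzX.
Qed.

Lemma phi_funM g h a : phi_fun (g * h)%g a = phi_fun g (phi_fun h a).
Proof.
pose f1 : {lrmorphism surface -> surface} := phi_fun (g * h)%g.
pose f2 : {lrmorphism surface -> surface} := phi_fun g \o phi_fun h.
apply: (@surface_morph_eq f1 f2) => /=;
  rewrite ?(phi_x, phi_y, phi_z) linearZ /= ?(phi_x, phi_y, phi_z) scalerA.
- by rewrite mulrC.
- by rewrite mulrC.
- by rewrite !exprMn invfM mulrACA mulrC.
Qed.

Lemma phi_fun1 a : phi_fun 1%g a = a.
Proof.
pose f1 : {lrmorphism surface -> surface} := phi_fun 1%g.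
pose f2 : {lrmorphism surface -> surface} := idfun.
by apply: (@surface_morph_eq f1 f2) => /=;
  rewrite ?(phi_x, phi_y, phi_z) /= ?expr1n ?invr1 ?mulr1 scale1r.
Qed.

Fact phi_bij g : bijective (phi_fun g : {lrmorphism surface -> surface}).
Proof.
by exists (phi_fun g^-1%g) => a /=; rewrite -phi_funM ?mulVg ?mulgV phi_fun1.
Qed.

Definition phi (g : Gcq) : algAut surface := AlgAut (phi_bij g).

Fact phi_morph : {morph phi : g h / (g * h)%g}.
Proof. by move=> g h; apply: algAutP => a; apply: phi_funM. Qed.

HB.instance Definition _ := isMultiplicative.Build Gcq (algAut surface) phi
  phi_morph.

End Surface.

(* Main.v *)
Require Import Defs.
From HB Require Import structures.
From mathcomp Require Import all_boot all_order all_algebra ring_quotient.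
From mathcomp Require Import boolp classical_sets.
From mathcomp Require Import mpoly.
From mathcomp Require Import zify ring.

Set Implicit Arguments.
Unset Strict Implicit.
Unset Printing Implicit Defensive.

Import GRing.Theory.
Local Open Scope ring_scope.
Local Open Scope classical_set_scope.

(** Let ev : K[x][y] -> A be the evaluation at the classes of x and y. It is
    injective, and every element of A becomes a polynomial in x and y after
    multiplication by a power of c.

    Leading exponents. As q is quasi-monic of degree d in y, the K[x]-module A
    is spanned by the y^j z^k with j < d, and y^j z^k = y^j q^k / c^k has
    degree j + d k in y: these degrees are pairwise distinct. So an element of
    degree m in y needs exactly the denominator c^(m %/ d)
    (exact_denominator), and its leading exponent (i, j), where j is the
    degree in y and i the degree in x of the leading coefficient, lies in the
    monoid generated by the exponents (1, 0), (0, 1) and (-n, d) of x, y and z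
    (lead_at_cone).

    Rigidity. A nonzero derivation D translates leading exponents by a fixed
    vector and multiplies leading coefficients by a linear form lam in the
    exponent (derivation_leading_term). When D is locally nilpotent, the
    exponents of f, D f, D (D f), and so on stay in the monoid until lam
    vanishes. Applied to x, y and z this is so restrictive, for n, d >= 2,
    that lam vanishes in the monoid only where j = 0 (cone_index_eq0); hence
    ker D lies in K[x] (kernel_in_Kx).

    Automorphisms. The derivation D0 with D0 x = 0 and D0 y = c is locally
    nilpotent. For an automorphism s, the conjugate s D0 s^-1 kills s x, so
    s x lies in K[x]; the same holds for s^-1, and composing gives
    s x = e x + a. Counting degrees in y gives s y = u y + h(x). Apply s to
    c(x) z = q(x, y): the element s z has degree d in y, so its denominator is
    c, and c(e x + a) is a scalar multiple of c. As c is centered, a = 0. Modulo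
    c the equation then reads q(e x, u y + h) = u^d q(x, y); as q is centered, c
    divides h, and as deg_x q < deg c the congruence
    q(e x, u y) = u^d q(x, y) is an equality (aut_normal_form). So psi takes
    its values in the group G of the pairs (e, u), and phi is a section.

    Kernel. If e = u = 1 and h = c g, then s is the exponential of the
    derivation x -> 0, y -> c g, by Taylor's formula (translation_is_exp).
    Conversely, exp D - 1 is locally nilpotent when D is, whereas s - 1
    multiplies x by e - 1 and, up to K[x], y by u - 1; so e = u = 1 when s is
    an exponential (exp_unipotent_coord). *)

(** * Evaluation and substitution *)

Lemma size_expM (R : idomainType) (p r : {poly R}) i : p != 0 -> r != 0 ->
  size (p ^+ i * r) = (deg p * i + size r)%N.
Proof.
move=> p0 r0; rewrite size_mul ?expf_neq0 //.
have := size_exp p i; have := size_poly_gt0 (p ^+ i).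
rewrite expf_neq0 // -/(deg p); set u := size (p ^+ i) => u0 <-.
by case: (u) u0.
Qed.

Section EvalXY.

Variables (K : closedFieldType) (B : comAlgType K) (a b : B).

(** Same function as eval_xy, with the polynomial as last argument, so that it
    can be declared a ring morphism. *)
Definition evxy (P : {poly {poly K}}) : B := eval_xy P a b.

Fact evxy_zmod_morphism : zmod_morphism evxy.
Proof. by move=> P Q; rewrite /evxy /eval_xy rmorphB hornerD hornerN. Qed.
Fact evxy_monoid_morphism : monoid_morphism evxy.
Proof.
split=> [|P Q]; first by rewrite /evxy /eval_xy rmorph1 hornerE.
by rewrite /evxy /eval_xy rmorphM hornerM.
Qed.
HB.instance Definition _ := GRing.isZmodMorphism.Build _ _ evxy
  evxy_zmod_morphism.
HB.instance Definition _ := GRing.isMonoidMorphism.Build _ _ evxy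
  evxy_monoid_morphism.

Lemma evxyC p : evxy p%:P = horner_alg a p.
Proof. by rewrite /evxy /eval_xy map_polyC hornerC. Qed.

Lemma evxyX : evxy 'X = b.
Proof. by rewrite /evxy /eval_xy map_polyX hornerX. Qed.

Lemma evxyCX : evxy 'X%:P = a.
Proof. by rewrite evxyC horner_algX. Qed.

Lemma evxyCC k : evxy k%:P%:P = k%:A.
Proof. by rewrite evxyC horner_algC. Qed.

End EvalXY.

Lemma degXM (R : idomainType) (p : {poly R}) : p != 0 ->
  deg ('X * p) = (deg p).+1.
Proof.
move=> p0; rewrite /deg mulrC size_mulX // prednK //.
by rewrite size_poly_gt0.
Qed.

Section EvMorph.

Variables (K : closedFieldType) (A : comAlgType K) (x y : A).
Local Notation ev := (evxy x y).

Lemma lrmorph_horner (B C : comAlgType K) (f : {lrmorphism B -> C}) (a : B) p :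
  f (horner_alg a p) = horner_alg (f a) p.
Proof.
elim/poly_ind: p => [|p k IH]; first by rewrite !rmorph0.
by rewrite !(rmorphD, rmorphM) /= !horner_algX !horner_algC IH linearZ /=
  rmorph1.
Qed.

Lemma lrmorph_ev (B C : comAlgType K) (f : {lrmorphism B -> C}) (a b : B) P :
  f (evxy a b P) = evxy (f a) (f b) P.
Proof.
elim/poly_ind: P => [|P p IH]; first by rewrite !rmorph0.
rewrite !(rmorphD, rmorphM) /= !evxyX IH; congr (_ + _).
by rewrite !evxyC lrmorph_horner.
Qed.

Lemma evxy_coef (B : comAlgType K) (a b : B) (P : {poly {poly K}}) m :
  (size P <= m)%N ->
  evxy a b P = \sum_(j < m) horner_alg a (P`_j) * b ^+ j.
Proof.
move=> sP; rewrite /evxy /eval_xy (@horner_coef_wide _ m).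
  by apply: eq_bigr => j _; rewrite coef_map.
exact: leq_trans (size_poly _ _) sP.
Qed.

Definition subst_xy (p : {poly K}) (Q P : {poly {poly K}}) : {poly {poly K}} :=
  map_poly (comp_poly p) P \Po Q.

Lemma horner_ev (p r : {poly K}) :
  horner_alg (ev p%:P) r = ev (r \Po p)%:P.
Proof.
rewrite !evxyC; elim/poly_ind: r => [|r k IHr].
  by rewrite comp_poly0 !rmorph0.
rewrite comp_polyD comp_polyM comp_polyX comp_polyC !(rmorphD, rmorphM) /=.
by rewrite !horner_algX !horner_algC IHr.
Qed.

Lemma evxy_subst p Q P : evxy (ev p%:P) (ev Q) P = ev (subst_xy p Q P).
Proof.
rewrite /subst_xy; elim/poly_ind: P => [|P r IH].
  by rewrite map_poly0 comp_poly0 !rmorph0.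
rewrite [map_poly _ _]rmorphD rmorphM /= map_polyX map_polyC /=.
rewrite comp_polyD comp_polyM comp_polyX comp_polyC !(rmorphD, rmorphM) /=.
by rewrite -IH !evxyX [evxy (ev _) _ _%:P]evxyC horner_ev.
Qed.

End EvMorph.

Section AffineSubst.

Variables (R : comNzRingType) (u h : R).
Local Notation aff := (u *: 'X + h%:P).

Lemma coef_affM p i : (aff * p)`_i.+1 = u * p`_i + h * p`_i.+1.
Proof. by rewrite mulrDl coefD -scalerAl coefZ coefXM coefCM. Qed.

Lemma size_aff_exp i : (size (aff ^+ i)%R <= i.+1)%N.
Proof.
elim: i => [|i IH]; first by rewrite expr0 size_poly1.
apply/leq_sizeP => -[//|j] ij; rewrite exprS coef_affM.
by rewrite !(leq_sizeP _ _ IH) ?mulr0 ?addr0 // ltnW.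
Qed.

Lemma coef_aff_exp_top i : (aff ^+ i)`_i = u ^+ i.
Proof.
elim: i => [|i IH]; first by rewrite !expr0 coef1.
rewrite exprS coef_affM IH [X in _ + h * X]nth_default ?size_aff_exp //.
by rewrite mulr0 addr0 exprS.
Qed.

Lemma coef_aff_exp_subtop i : (aff ^+ i.+1)`_i = i.+1%:R * u ^+ i * h.
Proof.
elim: i => [|i IH].
  by rewrite expr1 coefD coefZ coefX coefC mulr0 add0r expr0 !mul1r.
rewrite exprS coef_affM IH coef_aff_exp_top exprS -[i.+2%:R]natr1.
by ring.
Qed.

(** The subleading coefficient shows what centering is for: when p`_m = 0, it
    is h times m.+1%:R * u ^+ m * p`_m.+1, a nonzero factor in characteristic
    zero when u and p`_m.+1 are nonzero. *)
Lemma comp_affine_top (p : {poly R}) m : (size p <= m.+2)%N ->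
  (p \Po aff)`_m.+1 = u ^+ m.+1 * p`_m.+1 /\
  (p \Po aff)`_m = u ^+ m * p`_m + m.+1%:R * u ^+ m * h * p`_m.+1.
Proof.
move=> sp.
have -> : p \Po aff = \sum_(i < m.+2) p`_i *: aff ^+ i.
  rewrite comp_polyE (big_ord_widen m.+2 (fun i => p`_i *: aff ^+ i)) //.
  rewrite big_mkcond.
  apply: eq_bigr => i _; case: ltnP => // /(nth_default _) ->.
  by rewrite scale0r.
have coef_low j : (m <= j)%N -> (\sum_(i < m) p`_i *: aff ^+ i)`_j = 0.
  move=> mj; rewrite coef_sum big1 // => i _.
  rewrite coefZ [X in _ * X]nth_default ?mulr0 //.
  exact: leq_trans (size_aff_exp i) (leq_trans (ltn_ord i) mj).
rewrite !big_ord_recr /= !coefD !coefZ !coef_low // !coef_aff_exp_top.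
rewrite coef_aff_exp_subtop [(aff ^+ m)`_m.+1]nth_default ?size_aff_exp //.
by rewrite mulr0 !add0r; split; ring.
Qed.

Lemma comp_congr_mod (p V W : {poly R}) (c : {poly R}) :
  exists S, p \Po (V + c * W) = p \Po V + c * S.
Proof.
elim/poly_ind: p => [|p k [S IH]].
  by exists 0; rewrite !comp_poly0 mulr0 addr0.
exists ((p \Po V) * W + S * (V + c * W)).
rewrite !comp_polyD !comp_polyM !comp_polyX !comp_polyC IH.
move: (p \Po V) (k%:P) => pV k'.
by ring.
Qed.

End AffineSubst.

(** * Lexicographic leading terms of bivariate polynomials *)

Section Euler.

Variable R : idomainType.
Implicit Types p r : {poly R}.

(** Unlike p^`(), the polynomial X p' keeps the exponents in place and
    multiplies the coefficient of X^i by i, so that a derivation acts on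
    leading terms without any exponent being decreased. *)
Definition euler p : {poly R} := 'X * p^`().

Lemma coef_euler p i : (euler p)`_i = i%:R * p`_i.
Proof.
rewrite /euler coefXM; case: i => [|i] /=; first by rewrite mul0r.
by rewrite coef_deriv mulr_natl.
Qed.

Lemma size_euler p : (size (euler p) <= size p)%N.
Proof.
by apply/leq_sizeP => i pi; rewrite coef_euler nth_default ?mulr0.
Qed.

Lemma size_mul_le p r i j : (size p <= i.+1)%N -> (size r <= j.+1)%N ->
  (size (p * r)%R <= (i + j).+1)%N.
Proof.
move=> sp sr; apply: leq_trans (size_polyMleq p r) _.
by move: sp sr; set u := size _; set v := size _; lia.
Qed.

Lemma coefM_top p r i j : (size p <= i.+1)%N -> (size r <= j.+1)%N ->
  (p * r)`_(i + j) = p`_i * r`_j.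
Proof.
move=> sp sr; have ij : (i < (i + j).+1)%N by rewrite ltnS leq_addr.
rewrite coefM (bigD1 (Ordinal ij)) //= addKn big1 ?addr0 // => k ki.
have [lt_ki|le_ik] := ltnP k i.
  by rewrite [r`__]nth_default ?mulr0 //; apply: leq_trans sr _; lia.
rewrite nth_default ?mul0r //; apply: leq_trans sp _; rewrite ltn_neqAle le_ik.
by rewrite andbT eq_sym; apply: contraNneq ki => e; apply/eqP/val_inj.
Qed.

(** Used twice, for degrees in y and then in x, to choose one leading exponent
    for two polynomials. *)
Lemma top_index p r : p != 0 \/ r != 0 ->
  let m := (maxn (size p) (size r)).-1 in p`_m != 0 \/ r`_m != 0.
Proof.
rewrite /=; case: leqP => [le_pr|lt_rp] nz.
  right; rewrite -/(lead_coef r) lead_coef_eq0; case: nz => //.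
  by rewrite -!size_poly_gt0 => /leq_trans; apply.
left; rewrite -/(lead_coef p) lead_coef_eq0.
by rewrite -size_poly_gt0; apply: leq_ltn_trans lt_rp.
Qed.

End Euler.

Section Bivariate.

Variable R : idomainType.
Implicit Types P Q : {poly {poly R}}.

(** The leading exponent of P is at most (i, j) for the lexicographic order
    that compares degrees in y first. Nothing is asked of the lower powers of
    y, whose degree in x is irrelevant to this order. *)
Definition lex_le P (i j : nat) :=
  (size P <= j.+1)%N /\ (size (P`_j)%R <= i.+1)%N.

Lemma lex_leM P Q i j i' j' : lex_le P i j -> lex_le Q i' j' ->
  lex_le (P * Q) (i + i') (j + j') /\
  (P * Q)`_(j + j')`_(i + i') = P`_j`_i * Q`_j'`_i'.
Proof.
move=> [Pj Pi] [Qj Qi]; rewrite /lex_le coefM_top //.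
split; last exact: coefM_top.
by split; apply: size_mul_le.
Qed.

Lemma lex_leD P Q i j : lex_le P i j -> lex_le Q i j -> lex_le (P + Q) i j.
Proof.
move=> [Pj Pi] [Qj Qi]; rewrite /lex_le coefD.
by split; rewrite (leq_trans (size_polyD _ _)) // geq_max ?Pj ?Pi.
Qed.

Lemma lex_leB P Q i j : lex_le P i j -> lex_le Q i j -> lex_le (P - Q) i j.
Proof.
move=> lP [Qj Qi]; apply: lex_leD => //.
by rewrite /lex_le coefN !size_polyN.
Qed.

Lemma lex_le_lead P i j : lex_le P i j -> P`_j`_i != 0 ->
  [/\ P != 0, deg P = j & deg (lead_coef P) = i].
Proof.
move=> [Pj Pi] nz.
have Pj0 : P`_j != 0 by apply: contraNneq nz => ->; rewrite coef0.
have sP : size P = j.+1.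
  by apply/eqP; rewrite eqn_leq Pj ltnNge; apply: contra Pj0 => /leq_sizeP->.
have lP : lead_coef P = P`_j by rewrite /lead_coef sP.
split; [by rewrite -size_poly_eq0 sP|by rewrite /deg sP|].
suff -> : deg (lead_coef P) = (i.+1).-1 by [].
congr predn; apply/eqP; rewrite lP eqn_leq Pi ltnNge.
by apply: contra nz => /leq_sizeP->.
Qed.

Lemma lead_lex_le P : lex_le P (deg (lead_coef P)) (deg P).
Proof. by rewrite /lex_le -/(lead_coef P) /deg; split; exact: leqSpred. Qed.

Definition derivx P : {poly {poly R}} := map_poly (@deriv R) P.

Lemma derivx_mulXD P (p : {poly R}) :
  derivx (P * 'X + p%:P) = derivx P * 'X + p^`()%:P.
Proof.
apply/polyP => i; rewrite /derivx !(coef_map, coefD, coefMX, coefC) /=.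
by case: i => [|i] /=; rewrite !(addr0, add0r) // coef_map.
Qed.

Lemma coef_eulerx P i j : ('X%:P * derivx P)`_j`_i = i%:R * P`_j`_i.
Proof. by rewrite coefCM coef_map -/(euler _) coef_euler. Qed.

Lemma lex_le_eulerx P i j : lex_le P i j -> lex_le ('X%:P * derivx P) i j.
Proof.
move=> [Pj Pi]; split; last first.
  by rewrite coefCM coef_map; exact: leq_trans (size_euler _) Pi.
apply/leq_sizeP => k jk; rewrite coefCM coef_map.
by rewrite (leq_sizeP _ _ Pj) //= deriv0 mulr0.
Qed.

Lemma coef_eulery P i j : ('X * P^`())`_j`_i = j%:R * P`_j`_i.
Proof. by rewrite -/(euler P) coef_euler !mulr_natl coefMn. Qed.

Lemma lex_le_eulery P i j : lex_le P i j -> lex_le ('X * P^`()) i j.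
Proof.
move=> [Pj Pi]; split; first exact: leq_trans (size_euler _) Pj.
apply/leq_sizeP => k ik; rewrite coef_eulery.
by rewrite (leq_sizeP _ _ Pi) ?mulr0.
Qed.

End Bivariate.

(** * Derivations on polynomials in two elements *)

Section DerivationXY.

Variables (K : closedFieldType) (B : comAlgType K) (x y : B).
Variable D : {linear B -> B}.
Hypothesis DM : derivation D.
Local Notation ev := (evxy x y).

Lemma derivation1 : D 1 = 0.
Proof.
have /eqP := DM 1 1; rewrite !mulr1 mul1r addrC -subr_eq subrr eq_sym.
by move/eqP.
Qed.

Lemma derivation_alg k : D k%:A = 0.
Proof. by rewrite linearZ /= derivation1 scaler0. Qed.

Lemma derivation_evC p : D (ev p%:P) = ev (p^`()%:P) * D x.
Proof.
elim/poly_ind: p => [|p k IH].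
  by rewrite deriv0 !(rmorph0, mul0r) raddf0.
rewrite derivMXaddC !rmorphD !rmorphM /= !evxyCX evxyCC raddfD /= DM IH.
by rewrite derivation_alg addr0 mulrDl addrC mulrAC.
Qed.

Lemma derivation_ev P :
  D (ev P) = ev (derivx P) * D x + ev P^`() * D y.
Proof.
elim/poly_ind: P => [|P p IH].
  by rewrite /derivx deriv0 map_poly0 !(rmorph0, mul0r) raddf0 addr0.
rewrite derivx_mulXD derivMXaddC !rmorphD !rmorphM /= !evxyX raddfD /= DM IH.
rewrite derivation_evC !mulrDl -!addrA.
move: (D x) (D y) (ev P) (ev (derivx P)) (ev P^`()) (ev (p^`())%:P) => *.
by ring.
Qed.

End DerivationXY.

(** * The cone of leading exponents *)

Section ConeArithmetic.

Import Order.TTheory Num.Theory.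

(** The monoid generated by (1, 0), (0, 1) and (- n, d): here k is the
    quotient of j by d, the largest multiple of (- n, d) that j allows. *)
Definition in_cone (n d : nat) (i j : int) :=
  exists k r : nat,
    [/\ (r < d)%N, j = k%:Z * d%:Z + r%:Z & - (n%:Z * k%:Z) <= i].

(** The weight of an exponent (i, j) is p i + s j, scaled so that a translation
    by (D1, D2) lowers it by 1; x, y and z have weights p, s and r, and x and y
    are translated inside the cone until their weight is 0. Suppose that a
    point of weight 0 has j0 > 0. This point can only lie on the ray of z, so
    r = 0 and d s = n p. Then the cone conditions say how far j is from a
    multiple of d: the translates of y force d to divide 1 + k D2 for every k
    with 1 <= k <= s, which for s >= 2 gives d = 1; and for s = 1, the first
    translate of x gives n <= 1. *)
Lemma cone_index_eq0 (n d p s r : nat) (D1 D2 i0 j0 : int) :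
  (2 <= n)%N -> (2 <= d)%N ->
  p%:Z * D1 + s%:Z * D2 = -1 -> d%:Z * s%:Z = r%:Z + n%:Z * p%:Z ->
  p%:Z * i0 + s%:Z * j0 = 0 -> in_cone n d i0 j0 ->
  (forall k : nat, (k <= p)%N -> in_cone n d (1 + k%:Z * D1) (k%:Z * D2)) ->
  (forall k : nat, (k <= s)%N -> in_cone n d (k%:Z * D1) (1 + k%:Z * D2)) ->
  j0 = 0.
Proof.
move=> n2 d2 pD ds m0 [k0 [r0 [r0d j0E i0E]]] coneX coneY.
have [//|j00] := eqVneq j0 0; exfalso.
have j0_gt0 : 0 < j0 by lia.
have r_eq0 : r = 0%N.
  have : (d%:Z * s%:Z - n%:Z * p%:Z) * j0 <= 0.
    have -> : (d%:Z * s%:Z - n%:Z * p%:Z) * j0 =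
      - (d%:Z * p%:Z * i0 + n%:Z * p%:Z * j0).
      have -> : d%:Z * p%:Z * i0 = d%:Z * (p%:Z * i0) by ring.
      have -> : p%:Z * i0 = - (s%:Z * j0) by lia.
      ring.
    have : d%:Z * p%:Z * (- (n%:Z * k0%:Z)) <= d%:Z * p%:Z * i0.
      by apply: ler_wpM2l => //; exact: mulr_ge0.
    by rewrite j0E; nia.
  by rewrite ds; nia.
have {}ds : d%:Z * s%:Z = n%:Z * p%:Z by lia.
have p_gt0 : (0 < p)%N.
  case: p {coneX} pD m0 ds => // pD _; rewrite mulr0 => /eqP.
  by rewrite mulf_eq0 => /orP[] /eqP; [lia|move=> s0; move: pD; rewrite s0;
    lia].
have s_gt0 : (0 < s)%N by nia.
(* The k-th translate of y has weight s - k, and a cone point of the form     *)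
(* (i, t d + rho) has weight at least s rho; hence rho = 0 once k > 0.        *)
have dvdY k : (0 < k <= s)%N -> exists t : nat, 1 + k%:Z * D2 = t%:Z * d%:Z.
  move=> /andP[k0' ks]; have [t [rho [rd E1 E2]]] := coneY k ks; exists t.
  suff : rho = 0%N by lia.
  have : s%:Z * rho%:Z <= s%:Z - k%:Z; last by nia.
  have h1 : p%:Z * (- (n%:Z * t%:Z)) <= p%:Z * (k%:Z * D1) by apply: ler_wpM2l.
  have h2 : p%:Z * (k%:Z * D1) = k%:Z * (-1 - s%:Z * D2).
    have -> : p%:Z * (k%:Z * D1) = k%:Z * (p%:Z * D1) by ring.
    by congr (_ * _); lia.
  have h3 : p%:Z * (- (n%:Z * t%:Z)) = - (s%:Z * (t%:Z * d%:Z)).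
    have -> : p%:Z * (- (n%:Z * t%:Z)) = - ((n%:Z * p%:Z) * t%:Z) by ring.
    by rewrite -ds; ring.
  have h4 : s%:Z * (t%:Z * d%:Z) = s%:Z * (1 + k%:Z * D2 - rho%:Z).
    by congr (_ * _); lia.
  move: h1; rewrite h2 h3 h4; lia.
have [t1 t1E] := dvdY 1%N s_gt0.
have [s2|s1] := leqP 2 s.
  have [t2 t2E] := dvdY 2%N s2.
  have : (2 * t1%:Z - t2%:Z) * d%:Z = 1 by lia.
  by set m : int := _ - _; have [m_gt0|m_le0] := ltP 0 m; nia.
have {s1} s1 : s = 1%N by lia.
subst s; have [t [rho [rd E1 E2]]] := coneX 1%N p_gt0.
have tE : t%:Z = t1%:Z - 1 by nia.
have : p%:Z * (- (n%:Z * t%:Z)) <= p%:Z * (1 + 1%:Z * D1) by apply: ler_wpM2l.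
have -> : p%:Z * (- (n%:Z * t%:Z)) = - (n%:Z * p%:Z * t%:Z) by ring.
rewrite -ds tE; nia.
Qed.

(** The weight lam takes values in K, where it is only known that the
    translates of x, y and z reach weight 0. As lam is nonzero, so is its value
    L at (D1, D2); in characteristic zero, dividing by - L gives the integral
    weights above. *)
Lemma weight_cone_index_eq0 (K : fieldType) (n d : nat) (al be : K)
    (D1 D2 i0 j0 : int) :
  [pchar K] =i pred0 -> (2 <= n)%N -> (2 <= d)%N -> ~ (al = 0 /\ be = 0) ->
  let lam (i j : int) := al * i%:~R + be * j%:~R in
  let stops i j := exists2 k : nat, lam (i + k%:Z * D1) (j + k%:Z * D2) = 0 &
    forall k' : nat, (k' <= k)%N ->
      in_cone n d (i + k'%:Z * D1) (j + k'%:Z * D2) in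
  stops 1 0 -> stops 0 1 -> stops (- n%:Z) d%:Z ->
  lam i0 j0 = 0 -> in_cone n d i0 j0 -> j0 = 0.
Proof.
move=> chK n2 d2 nz lam stops [p lx cx] [s ly cy] [r lz _] l0 c0.
pose L := lam D1 D2.
have lamD i j k : lam (i + k * D1) (j + k * D2) = lam i j + k%:~R * L.
  by rewrite /L /lam !rmorphD !rmorphM /=; ring.
have intr0 (m : int) : m%:~R = 0 :> K -> m = 0.
  move/(pcharf0P K): chK => ch0.
  case: m => m; first by move/eqP; rewrite -pmulrn ch0 => /eqP->.
  by move/eqP; rewrite NegzE rmorphN oppr_eq0 /= -pmulrn ch0.
have alE : al = - p%:R * L.
  move: lx; rewrite lamD {1}/lam mulr0z mulr0 addr0 mulr1 => /eqP.
  by rewrite addr_eq0 mulNr => /eqP.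
have beE : be = - s%:R * L.
  move: ly; rewrite lamD {1}/lam mulr0z mulr0 add0r mulr1 => /eqP.
  by rewrite addr_eq0 mulNr => /eqP.
have L0 : L != 0.
  by apply/eqP => L0; apply: nz; rewrite alE beE L0 !mulr0.
have lamE i j : lam i j = - (p%:Z * i + s%:Z * j)%:~R * L.
  by rewrite /lam alE beE !rmorphD !rmorphM /=; ring.
have lam0 i j : lam i j = 0 -> p%:Z * i + s%:Z * j = 0.
  move=> /eqP; rewrite lamE mulf_eq0 (negPf L0) orbF oppr_eq0 => /eqP.
  exact: intr0.
apply: (@cone_index_eq0 n d p s r D1 D2 i0) => //.
- have : (- (p%:Z * D1 + s%:Z * D2) - 1)%:~R * L = 0.
    by rewrite rmorphB rmorphN mulrBl /= -lamE mul1r subrr.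
  move/eqP; rewrite mulf_eq0 (negPf L0) orbF => /eqP/intr0; lia.
- move: lz; rewrite lamD lamE -mulrDl => /eqP.
  rewrite mulf_eq0 (negPf L0) orbF -rmorphN -rmorphD => /eqP/intr0; lia.
- exact: lam0.
- by move=> k /cx; rewrite add0r.
- by move=> k /cy; rewrite add0r.
Qed.

End ConeArithmetic.

(** Integer identities between exponents. *)
Lemma shift_xE (a b e t u v : nat) : a.+1 = (e + (b + t))%N ->
  t%:Z - u%:Z + (e%:Z - 1 - v%:Z) = a%:Z - (b + (u + v))%N%:Z.
Proof. lia. Qed.

Lemma shift_yE (a e t : nat) : a.+1 = (e + (0 + t))%N ->
  t%:Z + (e%:Z - 1) = a%:Z.
Proof. lia. Qed.

Lemma add_step (i D : int) (k : nat) : i + D + k%:Z * D = i + k.+1%:Z * D.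
Proof. by rewrite -addn1 PoszD mulrDl mul1r -addrA [D + _]addrC. Qed.

(** * Exponentials of derivations are unipotent *)

Section Unipotent.

Variables (K : closedFieldType) (A : algType K).

(** exp D - 1 is D composed with a power series in D, so it lowers the order of
    nilpotency as much as D does. *)
Lemma is_exp_unipotent (D : {linear A -> A}) (s : algAut A) : is_exp D s ->
  forall k a, iter k D a = 0 -> iter k (fun b => s b - b) a = 0.
Proof.
move=> Ds; have iterA k : {morph iter k D : a b / a + b}.
  by elim: k => // k IH a b; rewrite !iterS IH raddfD.
have iterZ k r a : iter k D (r *: a) = r *: iter k D a.
  by elim: k => // k IH; rewrite !iterS IH linearZ.
have iter0 k : iter k D 0 = 0 by elim: k => // k IH; rewrite iterS IH raddf0.
elim=> [//|k IH] a ka; rewrite iterSr; apply: IH.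
rewrite (Ds _ _ ka) big_ord_recl.
rewrite fact0 invr1 scale1r [X in X - _]addrC addrK.
rewrite (big_morph (iter k D) (iterA k) (iter0 k)) big1 // => i _.
by rewrite iterZ -iterD lift0 addnS -addSn addnC iterD ka iter0 scaler0.
Qed.

End Unipotent.

(** * Normal forms and denominators *)

Section DanielewskiAlgebra.

Variables (K : closedFieldType) (c : {poly K}) (q : {poly {poly K}}).
Variables (A : comAlgType K) (x y z : A).

Local Notation n := (deg c).
Local Notation d := (deg q).
Local Notation ev := (evxy x y).

(* A stands for the surface algebra, known through these three properties of  *)
(* its presentation and, further down, through its derivations flow.          *)
Hypothesis rel : ev c%:P * z = ev q.
Hypothesis gen :
  forall a : A, exists g : {poly {poly {poly K}}}, a = (map_poly ev g).[z].
Hypothesis ev_inj : injective ev.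
Hypothesis charK : [pchar K] =i pred0.
Hypothesis c0 : c != 0.
Hypothesis n_ge2 : (2 <= n)%N.
Hypothesis q_qm : quasi_monic q.
Hypothesis d_ge2 : (2 <= d)%N.

Let d_gt0 : (0 < d)%N := ltnW d_ge2.

Lemma size_q : size q = d.+1.
Proof. by move: d_gt0; rewrite /deg; case: (size q). Qed.

Lemma q_neq0 : q != 0.
Proof. by rewrite -size_poly_eq0 size_q. Qed.

Lemma q_unit : lead_coef q \is a GRing.unit.
Proof.
by case: q_qm => k k0 ->; rewrite -mul_polyC mulr1 rmorph_unit ?unitfE.
Qed.

(** The combinations over K[x] of the y^j z^k with j < d, which form a basis of
    A. *)
Definition has_normal_form (a : A) := exists2 T : {poly {poly {poly K}}},
  forall i, (size (T`_i)%R <= d)%N & a = (map_poly ev T).[z].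

Lemma normal_formD a b : has_normal_form a -> has_normal_form b ->
  has_normal_form (a + b).
Proof.
move=> [T sT ->] [S sS ->]; exists (T + S); last by rewrite rmorphD hornerD.
by move=> i; rewrite coefD (leq_trans (size_polyD _ _)) // geq_max sT sS.
Qed.

Lemma normal_form_mulz a : has_normal_form a -> has_normal_form (a * z).
Proof.
move=> [T sT ->]; exists (T * 'X).
  by move=> [|i]; rewrite coefMX //= size_poly0.
by rewrite rmorphM /= map_polyX hornerMX.
Qed.

(** Euclidean division P = P1 q + R turns ev P into ev R + ev (c P1) z, and P1
    has lower degree in y than P. *)
Lemma normal_form_ev P : has_normal_form (ev P).
Proof.
have [N] := ubnP (size P); elim: N P => // N IH P sP.
have [->|P0] := eqVneq P 0.
  by exists 0; [move=> i; rewrite coef0 size_poly0|rewrite !rmorph0 horner0].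
rewrite (Pdiv.IdomainUnit.divp_eq q_unit P) addrC rmorphD rmorphM /=.
apply: normal_formD.
  exists (P %% q)%:P; last by rewrite map_polyC hornerC.
  move=> i; rewrite coefC; case: eqP => _; last by rewrite size_poly0.
  by rewrite -ltnS -size_q ltn_modpN0 ?q_neq0.
rewrite -rel mulrA -rmorphM; apply/normal_form_mulz/IH.
rewrite mulrC mul_polyC size_scale // size_divp ?q_neq0 //.
rewrite size_q; move: P0 d_gt0 sP; rewrite -size_poly_gt0.
by set m := size P; lia.
Qed.

Lemma normal_formP a : has_normal_form a.
Proof.
have [g ->] := gen a; elim/poly_ind: g => [|g P IH].
  exists 0; last by rewrite rmorph0 horner0.
  by move=> i; rewrite coef0 size_poly0.
rewrite rmorphD rmorphM /= map_polyX map_polyC hornerMXaddC.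
exact: normal_formD (normal_form_mulz IH) (normal_form_ev P).
Qed.

(** If k is the degree of the normal form T in z, then multiplying by c^k
    replaces z^i by c^(k - i) q^i. The terms T_i q^i occupy the disjoint ranges
    of degrees [d i, d i + d[ in y, so the last one dominates. *)
Lemma exact_denominator a : a != 0 -> exists k P,
  [/\ ev (c%:P ^+ k) * a = ev P, P != 0 & (deg P %/ d)%N = k].
Proof.
have [T sT ->] := normal_formP a => nz.
have T0 : T != 0 by apply: contraNneq nz => ->; rewrite rmorph0 horner0.
have sT1 : (0 < size T)%N by rewrite size_poly_gt0.
pose k := deg T.
have kE : size T = k.+1 by rewrite /k /deg prednK.
have Tk0 : T`_k != 0 by rewrite -[T`_k]/(lead_coef T) lead_coef_eq0.
pose F i : {poly {poly K}} := c%:P ^+ (k - i) * q ^+ i * T`_i.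
have sF (i : 'I_k) : (size (F i) <= k * d)%N.
  have [Ti|Ti] := eqVneq T`_i 0; first by rewrite /F Ti mulr0 size_poly0.
  rewrite /F -rmorphXn /= -mulrA mul_polyC.
  apply: (leq_trans (size_scale_leq _ _)); rewrite size_expM ?q_neq0 // mulnC.
  by apply: leq_trans (leq_add (leqnn _) (sT i)) _; rewrite -mulSnr leq_mul.
have sk : size (F k) = (k * d + size (T`_k)%R)%N.
  by rewrite /F subnn expr0 mul1r size_expM ?q_neq0 // mulnC.
have Tkpos : (0 < size (T`_k)%R)%N by rewrite size_poly_gt0.
have sS : (size (\sum_(i < k) F i)%R <= k * d)%N.
  by apply: (leq_trans (size_sum _ _ _)); apply/bigmax_leqP => i _; exact: sF.
pose P := \sum_(i < k.+1) F i.
have sP : size P = (k * d + size (T`_k)%R)%N.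
  rewrite /P big_ord_recr /= addrC size_polyDl sk //.
  by apply: leq_ltn_trans sS _; rewrite -[ltnLHS]addn0 ltn_add2l.
exists k, P; split.
- rewrite (@horner_coef_wide _ k.+1); last by rewrite -kE size_poly.
  rewrite mulr_sumr /P rmorph_sum; apply: eq_bigr => i _.
  rewrite coef_map /F !(rmorphM, rmorphXn) /= -rel exprMn.
  have ik : (i <= k)%N by rewrite -ltnS.
  by rewrite -{1}(subnK ik) exprD -!mulrA [_ * z ^+ i]mulrC.
- by rewrite -size_poly_gt0 sP addn_gt0 Tkpos orbT.
- rewrite /deg sP; have := sT k; rewrite -subn1 -addnBA // divnMDl //.
  by move: Tkpos; set v := size _ => v0 vd; rewrite divn_small ?addn0 //; lia.
Qed.

Lemma ev_eq0 P : ev P = 0 -> P = 0.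
Proof. by move=> P0; apply: ev_inj; rewrite P0 rmorph0. Qed.

(** Numerators multiply in the integral domain K[x][y]. *)
Lemma ev_mul_eq0 P a : P != 0 -> ev P * a = 0 -> a = 0.
Proof.
move=> P0 Pa; apply/eqP; apply/negPn/negP =>
  /exact_denominator[k [Q [kQ Q0 _]]].
have : P * Q = 0 by apply: ev_eq0; rewrite rmorphM /= -kQ mulrCA Pa mulr0.
by apply/eqP; rewrite mulf_neq0.
Qed.

Lemma mul_cX_inj k a b : ev (c%:P ^+ k) * a = ev (c%:P ^+ k) * b -> a = b.
Proof.
move/eqP; rewrite -subr_eq0 -mulrBr => /eqP ab; apply/eqP; rewrite -subr_eq0.
by apply/eqP; apply: ev_mul_eq0 ab; rewrite expf_neq0 ?polyC_eq0.
Qed.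

Lemma clear_denom a : exists k P, ev (c%:P ^+ k) * a = ev P.
Proof.
have [->|/exact_denominator[k [P [kP _ _]]]] := eqVneq a 0; last by exists k, P.
by exists 0%N, 0; rewrite mulr0 rmorph0.
Qed.

(** * Leading exponents and derivations *)

(** Leading exponent of f = P / c^k, with the degree in x of the denominator
    subtracted; the first component may be negative, hence the integers. *)
Definition lead_at (f : A) (i j : int) := exists k P,
  [/\ ev (c%:P ^+ k) * f = ev P, P != 0,
      i = (deg (lead_coef P))%:Z - (n * k)%:Z & j = (deg P)%:Z].

Lemma lead_at_neq0 f i j : lead_at f i j -> f != 0.
Proof.
move=> [k [P [kP P0 _ _]]]; apply: contraNneq P0 => f0.
by apply/eqP/ev_eq0; rewrite -kP f0 mulr0.
Qed.

Lemma deg_mul_cX k P : P != 0 -> deg (c%:P ^+ k * P) = deg P.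
Proof.
move=> P0; rewrite -rmorphXn /= mul_polyC /deg.
have ck : c ^+ k != 0 by rewrite expf_neq0.
by rewrite size_scale.
Qed.

Lemma deg_lead_mul_cX k P : P != 0 ->
  deg (lead_coef (c%:P ^+ k * P)) = (n * k + deg (lead_coef P))%N.
Proof.
move=> P0; rewrite lead_coefM lead_coef_exp lead_coefC /deg.
rewrite size_expM // ?lead_coef_eq0 //; rewrite /deg.
have : (0 < size (lead_coef P))%N by rewrite size_poly_gt0 lead_coef_eq0.
by case: (size (lead_coef P)) => // m _; rewrite addnS.
Qed.

(** Compare any numerator of f with the one over the exact denominator, whose
    leading coefficient has degree at least 0. *)
Lemma lead_at_cone f i j : lead_at f i j -> in_cone n d i j.
Proof.
move=> fij; have f0 := lead_at_neq0 fij.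
have [k [P [kP P0 -> ->]]] := fij.
have [l [Q [lQ Q0 dQ]]] := exact_denominator f0.
have PQ : c%:P ^+ l * P = c%:P ^+ k * Q.
  by apply: ev_inj; rewrite !rmorphM /= -kP -lQ mulrCA.
exists l, (deg P %% d)%N; rewrite ltn_mod d_gt0.
have eP : deg P = deg Q by have := congr1 (@deg _) PQ; rewrite !deg_mul_cX.
split=> //.
  by rewrite -PoszM -PoszD -dQ -eP -divn_eq.
have := congr1 (fun S => deg (lead_coef S)) PQ; rewrite !deg_lead_mul_cX //.
set u := deg _; set v := deg _; rewrite -!PoszM; lia.
Qed.

Lemma lead_at_x : lead_at x 1 0.
Proof.
exists 0%N, 'X%:P; rewrite expr0 rmorph1 mul1r evxyCX polyC_eq0 polyX_eq0.
by rewrite muln0 lead_coefC /deg size_polyX size_polyC polyX_eq0.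
Qed.

Lemma lead_at_y : lead_at y 0 1.
Proof.
exists 0%N, 'X; rewrite expr0 rmorph1 mul1r evxyX polyX_eq0.
by rewrite muln0 lead_coefX /deg size_polyX size_poly1.
Qed.

Lemma lead_at_z : lead_at z (- n%:Z) d%:Z.
Proof.
exists 1%N, q; rewrite expr1 rel muln1 -size_poly_gt0; split=> //.
  by move: d_gt0; rewrite /deg; case: (size q).
have [k k0 ->] := q_qm; rewrite -mul_polyC mulr1 /deg size_polyC k0.
by rewrite add0r.
Qed.

Section Derivation.

Variable D : {linear A -> A}.
Hypothesis DM : derivation D.

(** Differentiate c^k f = P, and multiply by c^(s + 1) so as to clear the
    denominators of D x and D y and the quotient c' / c. *)
Lemma derivation_numerator k s f P U V :
  ev (c%:P ^+ k) * f = ev P -> ev (c%:P ^+ s) * D x = ev U ->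
  ev (c%:P ^+ s) * D y = ev V ->
  ev (c%:P ^+ (k + s).+1) * D f =
  ev (U * (c%:P * derivx P - (c^`() *+ k)%:P * P) + V * (c%:P * P^`())).
Proof.
move=> fP xU yV.
have E : ev c%:P * D (ev (c%:P ^+ k)) =
  ev (c^`() *+ k)%:P * ev (c%:P ^+ k) * D x.
  rewrite -rmorphXn /= (derivation_evC _ _ DM) mulrA -!rmorphM /=;
    congr (ev _%:P * _).
  rewrite deriv_exp mulrnAr; case: k {fP} => [|k];
    first by rewrite !mulr0n mul0r.
  by rewrite /= exprS mulrCA mulrnAl.
have := DM (ev (c%:P ^+ k)) f; rewrite fP (derivation_ev _ _ DM) => E2.
rewrite exprS exprD !(rmorphM, rmorphD, rmorphN) /= -xU -yV -fP.
move: (ev c%:P) (ev (c%:P ^+ k)) (ev (c%:P ^+ s)) (ev (c^`() *+ k)%:P)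
  (ev (derivx P)) (ev P^`()) (D _) (D x) (D y) (D f) E E2
  => C Ck Cs e px py dCk X' Y' F E E2.
transitivity (Cs * (C * (px * X' + py * Y') - e * Ck * X' * f)).
  by rewrite E2 -E; ring.
by ring.
Qed.

Hypothesis D_neq0 : ~ (D x = 0 /\ D y = 0).

(** On monomials, x y D multiplies x^i y^j by i (y D x) + j (x D y); after
    multiplication by c^s, the elements y D x and x D y are the polynomials S
    and T below. The larger of their leading exponents gives the translation,
    and their coefficients al and be there, not both zero, the linear form. *)
Lemma derivation_leading_term : exists (D1 D2 : int) (al be : K),
  ~ (al = 0 /\ be = 0) /\
  forall f i j, lead_at f i j -> al * i%:~R + be * j%:~R != 0 ->
    lead_at (D f) (i + D1) (j + D2).
Proof.
have [kx [U' xU']] := clear_denom (D x).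
have [ky [V' yV']] := clear_denom (D y).
pose s := (ky + kx)%N.
pose U := c%:P ^+ ky * U'; pose V := c%:P ^+ kx * V'.
have xU : ev (c%:P ^+ s) * D x = ev U.
  by rewrite /s exprD !rmorphM -mulrA xU'.
have yV : ev (c%:P ^+ s) * D y = ev V.
  by rewrite /s addnC exprD !rmorphM -mulrA yV'.
pose S : {poly {poly K}} := 'X * U; pose T : {poly {poly K}} := 'X%:P * V.
have nz : S != 0 \/ T != 0.
  have [S0|] := eqVneq S 0; last by left.
  have [T0|] := eqVneq T 0; last by right.
  have U0 : U = 0.
    by apply/eqP; move/eqP: S0; rewrite /S mulf_eq0 polyX_eq0.
  have V0 : V = 0.
    by apply/eqP; move/eqP: T0; rewrite /T mulf_eq0 polyC_eq0 polyX_eq0.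
  by case: D_neq0; split; apply: (@mul_cX_inj s);
    rewrite ?xU ?yV ?U0 ?V0 rmorph0 mulr0.
pose J := (maxn (size S) (size T)).-1.
pose I := (maxn (size S`_J) (size T`_J)).-1.
have bnz : S`_J`_I != 0 \/ T`_J`_I != 0 := top_index (top_index nz).
have leS : lex_le S I J.
  by split; apply: leq_trans (leqSpred _); rewrite leq_maxl.
have leT : lex_le T I J.
  by split; apply: leq_trans (leqSpred _); rewrite leq_maxr.
exists (I%:Z - 1 - (n * s)%:Z), (J%:Z - 1), S`_J`_I, T`_J`_I; split.
  by case=> b0 b0'; case: bnz; rewrite ?b0 ?b0' eqxx.
move=> f i j [k [P [fP P0 iE jE]]] lam.
pose l := deg (lead_coef P); pose m := deg P.
pose W := U * (c%:P * derivx P - (c^`() *+ k)%:P * P) + V * (c%:P * P^`()).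
have DfW := derivation_numerator fP xU yV; rewrite -/W in DfW.
have xyW : 'X%:P * ('X * W) =
    S * (c%:P * ('X%:P * derivx P) - (euler c *+ k)%:P * P)
    + T * (c%:P * ('X * P^`())).
  rewrite /W /S /T /euler -mulrnAr polyCM.
  have ringE (R : comNzRingType) (X Y u v C px e p py : R) :
      Y * (X * (u * (C * px - e * p) + v * (C * py))) =
      X * u * (C * (Y * px) - Y * e * p) + Y * v * (C * (X * py)) by ring.
  exact: ringE.
have leC : lex_le (c%:P : {poly {poly K}}) n 0.
  by split; rewrite ?size_polyC ?leq_b1 ?coefC //= /deg leqSpred.
have leE : lex_le ((euler c *+ k)%:P : {poly {poly K}}) n 0.
  split; rewrite ?size_polyC ?leq_b1 ?coefC //=.
  rewrite -mulr_natl -polyC_natr mul_polyC.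
  apply: leq_trans (size_scale_leq _ _) _; apply: leq_trans (size_euler _) _.
  exact: leqSpred.
have leP := lead_lex_le P; rewrite -/l -/m in leP.
have [leX cX] := lex_leM leC (lex_le_eulerx leP).
have [leY cY] := lex_leM leC (lex_le_eulery leP).
have [leZ cZ] := lex_leM leE leP.
have [le1 c1] := lex_leM leS (lex_leB leX leZ).
have [le2 c2] := lex_leM leT leY.
have le3 := lex_leD le1 le2; rewrite -xyW in le3.
have a0 : P`_m`_l != 0 by rewrite -!/(lead_coef _) !lead_coef_eq0.
have c30 : ('X%:P * ('X * W))`_(J + (0 + m))`_(I + (n + l)) =
    c`_n * P`_m`_l * (S`_J`_I * i%:~R + T`_J`_I * j%:~R).
  rewrite xyW 2!coefD c1 c2 2!coefD 2!coefN cX cY cZ !coefC /=.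
  rewrite coef_eulerx coef_eulery coefMn coef_euler.
  rewrite iE jE -/l -/m rmorphB /= -!pmulrn natrM.
  rewrite -[_ * _ *+ k]mulr_natl.
  move: (c`_n) (P`_m`_l) (S`_J`_I) (T`_J`_I) (l%:R : K) (m%:R : K) (n%:R : K)
    (k%:R : K) => *.
  by ring.
have [] := lex_le_lead le3.
  by rewrite c30 !mulf_neq0 // -/(lead_coef c) lead_coef_eq0.
rewrite !mulf_eq0 => /norP[_ /norP[_ W0]] dW lW.
exists (k + s).+1, W; rewrite DfW; split=> //.
- move: lW; rewrite !lead_coefM lead_coefC lead_coefX mul1r.
  rewrite degXM ?lead_coef_eq0 // iE -/l mulnS mulnDr.
  exact: shift_xE.
- move: dW; rewrite mul_polyC /deg size_scale ?polyX_eq0 // -!/(deg _) degXM //.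
  by rewrite jE; exact: shift_yE.
Qed.

End Derivation.

(** * Locally nilpotent derivations and their kernels *)

(** Below degree d in y the exact denominator is 1. *)
Lemma low_degree_polynomial k P a : ev (c%:P ^+ k) * a = ev P ->
  (size P <= d)%N ->
  exists2 r, a = ev r & (size r <= size P)%N.
Proof.
move=> kP sP; have [->|/exact_denominator[l [Q [lQ Q0 dQ]]]] := eqVneq a 0.
  by exists 0; rewrite ?rmorph0 ?size_poly0.
have PQ : c%:P ^+ l * P = c%:P ^+ k * Q.
  by apply: ev_inj; rewrite !rmorphM /= -kP -lQ mulrCA.
have sPQ : size P = size Q.
  have ck m : c ^+ m != 0 by rewrite expf_neq0.
  have := congr1 (fun S : {poly {poly K}} => size S) PQ.
  by rewrite -!rmorphXn /= !mul_polyC !size_scale.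
exists Q; last by rewrite sPQ.
suff l0 : l = 0%N by rewrite -lQ l0 expr0 rmorph1 mul1r.
rewrite -dQ divn_small // /deg -sPQ; move: sP; rewrite sPQ.
by have := Q0; rewrite -size_poly_gt0; case: (size Q).
Qed.

Lemma degree0_polynomial k p a : ev (c%:P ^+ k) * a = ev p%:P ->
  exists r, a = ev r%:P.
Proof.
move=> kp; have s1 : (size (p%:P : {poly {poly K}}) <= 1)%N.
  by rewrite size_polyC leq_b1.
have [r -> sr] := low_degree_polynomial kp (leq_trans s1 d_gt0).
by exists r`_0; rewrite -size1_polyC // (leq_trans sr).
Qed.

(** Leading exponents follow the translations for as long as the linear form
    does not vanish; since D^N f = 0, it has to vanish along the way. *)
Lemma lead_at_orbit (D : {linear A -> A}) (D1 D2 : int) (al be : K) N :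
  (forall f i j, lead_at f i j -> al * i%:~R + be * j%:~R != 0 ->
    lead_at (D f) (i + D1) (j + D2)) ->
  forall f i j, lead_at f i j -> iter N D f = 0 ->
  exists2 k : nat,
    al * (i + k%:Z * D1)%:~R + be * (j + k%:Z * D2)%:~R = 0 &
    forall k' : nat, (k' <= k)%N ->
      in_cone n d (i + k'%:Z * D1) (j + k'%:Z * D2).
Proof.
move=> shift; elim: N => [|N IH] f i j fij.
  by move=> f0; have := lead_at_neq0 fij; rewrite /= in f0; rewrite f0 eqxx.
have [l0 _|l0] := eqVneq (al * i%:~R + be * j%:~R) 0.
  exists 0%N; first by rewrite !mul0r !addr0.
  by case=> // _; rewrite !mul0r !addr0; exact: lead_at_cone fij.
rewrite iterSr => /(IH _ _ _ (shift _ _ _ fij l0))[k k0 kc].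
exists k.+1; first by rewrite -!add_step.
case=> [_|k' k'k]; first by rewrite !mul0r !addr0; exact: lead_at_cone fij.
by rewrite -!add_step; exact: kc.
Qed.

(** The linear form vanishes at the leading exponent of X, since D X = 0; by
    the cone lemma X then has degree 0 in y. *)
Lemma kernel_in_Kx (D : {linear A -> A}) (X : A) :
  derivation D -> locally_nilpotent D -> ~ (D x = 0 /\ D y = 0) -> D X = 0 ->
  exists p, X = ev p%:P.
Proof.
move=> DM Dnil D0 DX.
have [->|X0] := eqVneq X 0; first by exists 0; rewrite !rmorph0.
have [D1 [D2 [al [be [nz shift]]]]] := derivation_leading_term DM D0.
have [k [P [kP P0 _]]] := exact_denominator X0.
pose i0 := (deg (lead_coef P))%:Z - (n * k)%:Z.
have Xval : lead_at X i0 (deg P)%:Z by exists k, P.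
have stop f i j : lead_at f i j -> exists2 k : nat,
    al * (i + k%:Z * D1)%:~R + be * (j + k%:Z * D2)%:~R = 0 &
    forall k' : nat, (k' <= k)%N ->
      in_cone n d (i + k'%:Z * D1) (j + k'%:Z * D2).
  by move=> fij; have [N _ DN] := Dnil f;
    exact: lead_at_orbit shift _ _ _ fij DN.
have lX : al * i0%:~R + be * (deg P)%:~R = 0.
  apply/eqP/negPn/negP => /(shift _ _ _ Xval)/lead_at_neq0.
  by rewrite DX eqxx.
have : (deg P)%:Z = 0.
  have Xcone := lead_at_cone Xval.
  apply: (weight_cone_index_eq0 charK n_ge2 d_ge2 nz _ _ _ lX Xcone).
  - exact: stop lead_at_x.
  - exact: stop lead_at_y.
  - exact: stop lead_at_z.
case=> dP; apply: (@degree0_polynomial k P`_0); rewrite kP -size1_polyC //.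
by move: dP; rewrite /deg; case: (size P) => [|[|]].
Qed.

(** * Automorphisms act affinely on x and on y over K[x] *)

Section Triangular.

Variables (D : {linear A -> A}) (h : {poly K}).
Hypotheses (DM : derivation D) (Dx : D x = 0) (Dy : D y = ev h%:P).

(** Such a D acts on numerators as h times the derivation in y, and leaves the
    denominators alone. *)
Lemma iter_triangular k f P : ev (c%:P ^+ k) * f = ev P ->
  forall i, ev (c%:P ^+ k) * iter i D f = ev (h%:P ^+ i * P^`(i)).
Proof.
move=> fP; elim=> [|i IH]; first by rewrite expr0 mul1r derivn0.
have := DM (ev (c%:P ^+ k)) (iter i D f).
rewrite IH derivation_ev // Dx mulr0 add0r Dy -!polyC_exp derivation_evC //.
rewrite Dx mulr0 mul0r add0r => <-; rewrite -rmorphM; congr ev.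
by rewrite derivnS deriv_mulC exprS polyCM mulrC mulrA.
Qed.

Lemma triangular_nilpotent : locally_nilpotent D.
Proof.
move=> f; have [k [P fP]] := clear_denom f.
exists (size P).+1 => //; apply: (@mul_cX_inj k).
by rewrite (iter_triangular fP) mulr0 derivn_poly0 ?mulr0 ?rmorph0.
Qed.

End Triangular.

Hypothesis flow : forall g : {poly K}, exists D : {linear A -> A},
  [/\ derivation D, D x = 0 & D y = ev (c * g)%:P].

Lemma derivation_eq0 (D : {linear A -> A}) (f : A) : derivation D ->
  D x = 0 -> D y = 0 -> D f = 0.
Proof.
move=> DM Dx Dy; have [k [P fP]] := clear_denom f.
apply: (@mul_cX_inj (k + 0).+1).
by rewrite (@derivation_numerator D DM k 0 f P 0 0) ?Dx ?Dy ?mulr0 ?mul0r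
  ?addr0 ?rmorph0.
Qed.

(** The conjugate by s of the derivation x -> 0, y -> c is locally nilpotent
    and kills s x. *)
Lemma aut_x_in_Kx (s : algAut A) : exists p, s x = ev p%:P.
Proof.
have [D0 [D0M D0x D0y]] := flow 1.
have D0nil := triangular_nilpotent D0M D0x D0y.
pose D : {linear A -> A} := (s \o D0 \o (s^-1)%g).
have sK a : s ((s^-1)%g a) = a by exact: algAut_inv_funK.
have sK' a : (s^-1)%g (s a) = a by exact: algAut_funK.
have iterD k a : iter k D a = s (iter k D0 ((s^-1)%g a)).
  by elim: k => [|k IH]; [rewrite /= sK|rewrite !iterS IH /= sK'].
have DM : derivation D.
  by move=> a b; rewrite /D /= rmorphM D0M rmorphD !rmorphM /= !sK.
apply: (@kernel_in_Kx D).
- exact: DM.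
- move=> a; have [k k0 ka] := D0nil ((s^-1)%g a).
  by exists k; rewrite // iterD ka rmorph0.
- case=> Dx Dy; have := derivation_eq0 (s y) DM Dx Dy.
  rewrite /D /= sK' D0y mulr1 => /(congr1 (s^-1)%g); rewrite sK' rmorph0.
  by move/ev_eq0/eqP; rewrite polyC_eq0 (negPf c0).
- by rewrite /D /= sK' D0x rmorph0.
Qed.

(** The polynomials of s and of s^-1 are inverse to each other for composition,
    and degrees multiply under composition. *)
Lemma aut_x_degree1 (s : algAut A) p : s x = ev p%:P -> size p = 2%N.
Proof.
move=> sx; have [r rx] := aut_x_in_Kx (s^-1)%g.
have : s ((s^-1)%g x) = x by exact: algAut_inv_funK.
rewrite rx evxyC lrmorph_horner sx horner_ev -[in RHS](evxyCX x y).
move/ev_inj/polyC_inj => rp; have := size_comp_poly r p; rewrite rp size_polyX.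
by move/esym/eqP; rewrite muln_eq1 => /andP[_]; case: (size p) => [|[|[|]]].
Qed.

(** Write s^-1 y = P(x, y) / c^l; then y = P(s x, s y) / (s c)^l. Clearing the
    denominators of s y, the right-hand side is a composite G(Q), whose degree
    in y is the product of the degrees of G and of Q, while the left-hand side
    has degree 1. So Q has degree 1, and as 1 < d no denominator is left. *)
Lemma aut_y_degree1 (s : algAut A) : exists2 Q, s y = ev Q & size Q = 2%N.
Proof.
have [p sx] := aut_x_in_Kx s; have sp := aut_x_degree1 sx.
have sK a : s ((s^-1)%g a) = a by exact: algAut_inv_funK.
have sK' a : (s^-1)%g (s a) = a by exact: algAut_funK.
have sy0 : s y != 0.
  apply/eqP => /(congr1 (s^-1)%g); rewrite sK' rmorph0 -(evxyX x y) => /ev_eq0.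
  by move/eqP; rewrite polyX_eq0.
have [k [Q [kQ Q0 dQ]]] := exact_denominator sy0.
have [l [P lP]] := clear_denom ((s^-1)%g y).
have := congr1 s lP; rewrite rmorphM /= sK !lrmorph_ev sx.
have cp0 : c \Po p != 0.
  by rewrite comp_poly_eq0 // sp.
have -> : evxy (ev p%:P) (s y) (c%:P ^+ l) = ev ((c \Po p) ^+ l)%:P.
  by rewrite -polyC_exp [LHS]evxyC horner_ev rmorphXn.
pose N := deg P.
pose G : {poly {poly K}} :=
  \poly_(j < N.+1) ((P`_j \Po p) * c ^+ (k * (N - j))).
have evG : ev (c%:P ^+ (k * N)) * evxy (ev p%:P) (s y) P = ev (G \Po Q).
  rewrite [evxy (ev p%:P) _ _](evxy_coef _ _ (leqSpred _)) /G poly_def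
    raddf_sum rmorph_sum mulr_sumr.
  apply: eq_bigr => j _; have jN : (j <= N)%N by rewrite -ltnS.
  rewrite /= comp_polyZ comp_Xn_poly -mul_polyC rmorphM rmorphXn /= -kQ exprMn.
  rewrite horner_ev polyCM rmorphM /= -{1}(subnK jN) mulnDr exprD !rmorphM /=.
  rewrite polyC_exp exprM -[(ev _) ^+ j]rmorphXn /= -[(c%:P ^+ k) ^+ j]exprM.
  by rewrite mulrACA [_ * ev (_%:P)]mulrC.
move=> yP.
have /ev_inj GQ :
    ev (((c ^+ (k * N)) * (c \Po p) ^+ l)%:P * 'X) = ev (G \Po Q).
  by rewrite -evG -yP polyCM !rmorphM /= evxyX -polyC_exp mulrA.
have := size_comp_poly G Q; rewrite -GQ.
rewrite size_mulX ?polyC_eq0 ?mulf_neq0 ?expf_neq0 // size_polyC.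
rewrite mulf_neq0 ?expf_neq0 //= => /esym/eqP; rewrite muln_eq1 => /andP[_ dQ1].
exists Q; last by move: dQ1; case: (size Q) => [|[|[|]]].
suff k0 : k = 0%N by rewrite -kQ k0 expr0 rmorph1 mul1r.
by rewrite -dQ /deg (eqP dQ1) divn_small.
Qed.

(** The coefficients of y in s y and in s^-1 y are, up to a substitution in x,
    inverse to each other in K[x]. *)
Lemma aut_y_affine (s : algAut A) : exists (u : K) (h : {poly K}),
  u != 0 /\ s y = ev (u%:P%:P * 'X + h%:P).
Proof.
have [p sx] := aut_x_in_Kx s.
have [Q sy sQ] := aut_y_degree1 s; have [R ry sR] := aut_y_degree1 (s^-1)%g.
have deg1E (S : {poly {poly K}}) : size S = 2%N ->
  S = (S`_1)%:P * 'X + (S`_0)%:P.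
  move=> sS; apply/polyP => i; rewrite coefD coefCM coefX coefC.
  case: i => [|[|i]]; rewrite ?mulr0 ?add0r ?mulr1 ?addr0 //=.
  by rewrite nth_default ?sS.
have : s ((s^-1)%g y) = y by exact: algAut_inv_funK.
rewrite ry lrmorph_ev sx sy evxy_subst -[in RHS](evxyX x y) => /ev_inj.
rewrite /subst_xy (deg1E _ sR) rmorphD rmorphM /= map_polyX !map_polyC /=.
rewrite comp_polyD comp_polyM comp_polyX !comp_polyC.
move=> /(congr1 (fun S : {poly {poly K}} => S`_1)).
rewrite coefD coefCM coefC addr0 coefX /= => RQ.
have : Q`_1 \is a GRing.unit.
  by apply/unitrP; exists (R`_1 \Po p); rewrite [in X in _ /\ X]mulrC.
rewrite poly_unitE => /andP[/eqP s1 u1].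
exists (Q`_1)`_0, Q`_0; split; first by move: u1; rewrite unitfE.
by rewrite {1}(deg1E _ sQ) {1}(size1_polyC (eq_leq s1)).
Qed.

Lemma aut_x_affine (s : algAut A) : exists e a : K,
  e != 0 /\ s x = ev (e *: 'X + a%:P)%:P.
Proof.
have [p sx] := aut_x_in_Kx s; have sp := aut_x_degree1 sx.
exists p`_1, p`_0; split.
  by have : lead_coef p != 0;
    [rewrite lead_coef_eq0 -size_poly_eq0 sp|rewrite /lead_coef sp].
rewrite sx; congr (ev _%:P); apply/polyP => i; rewrite coefD coefZ coefX coefC.
case: i => [|[|i]]; rewrite ?mulr0 ?add0r ?mulr1 ?addr0 //=.
by rewrite nth_default ?sp.
Qed.

(** * Consequences of the reduced form *)

Lemma natK_neq0 m : (0 < m)%N -> m%:R != 0 :> K.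
Proof. by move=> m0; rewrite (pcharf0P K).1 // -lt0n. Qed.

Section Auto.

Variables (s : algAut A) (e a u : K) (h : {poly K}).
Hypotheses (e0 : e != 0) (u0 : u != 0).
Hypothesis sx : s x = ev (e *: 'X + a%:P)%:P.
Hypothesis sy : s y = ev (u%:P *: 'X + h%:P).
Local Notation p := (e *: 'X + a%:P).

(* q1 and Q are variables with equations rather than definitions: unification *)
(* must not unfold the substitutions when it compares them with q.            *)
Variables q1 Q : {poly {poly K}}.
Hypothesis q1E : q1 = map_poly (comp_poly p) q.
Hypothesis QE : Q = q1 \Po (u%:P *: 'X + h%:P).

Lemma size_affine (R : idomainType) (v b : R) : v != 0 ->
  size (v *: 'X + b%:P) = 2%N.
Proof.
move=> v0; rewrite size_polyDl size_scale ?size_polyX //.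
by rewrite size_polyC; case: eqP.
Qed.

Lemma aut_z_rel : ev (c \Po p)%:P * s z = ev Q.
Proof.
have := congr1 s rel; rewrite rmorphM /= !lrmorph_ev sx sy.
by rewrite [evxy _ _ c%:P]evxyC horner_ev evxy_subst QE q1E.
Qed.

Lemma lead_q : exists2 k : K, k != 0 & q`_d = k%:P.
Proof.
have [k k0 qk] := q_qm; exists k => //.
by rewrite -[q`_d]/(lead_coef q) qk -mul_polyC mulr1.
Qed.

Lemma size_q1 : size q1 = d.+1.
Proof.
have [k k0 qk] := lead_q.
have sq : size q = d.+1 by rewrite size_q.
rewrite -sq q1E size_map_poly_id0 // -[lead_coef q]/(q`_d) qk.
by rewrite comp_polyC polyC_eq0.
Qed.

Lemma subst_q_top k : q`_d = k%:P -> Q`_d = (u ^+ d * k)%:P /\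
  Q`_d.-1 = (u ^+ d.-1)%:P * q1`_d.-1 + (d%:R * u ^+ d.-1 * k) *: h.
Proof.
move=> qk; have sq1 : (size q1 <= d.-1.+2)%N by rewrite size_q1 prednK.
have [] := comp_affine_top u%:P h sq1; rewrite prednK // -QE => -> ->.
have -> : q1`_d = k%:P by rewrite q1E coef_map qk /= comp_polyC.
split; first by rewrite polyCM polyC_exp.
rewrite polyC_exp -mul_polyC !polyCM polyC_natr polyC_exp; congr (_ + _).
by rewrite mulrAC.
Qed.

Lemma size_subst_q : size Q = d.+1.
Proof.
have [k k0 qk] := lead_q; have [Qd _] := subst_q_top qk.
have Q0 : Q != 0.
  apply/eqP => Qe; move: Qd; rewrite Qe coef0 => /esym/eqP.
  by apply/negP; rewrite polyC_eq0 mulf_neq0 ?expf_neq0.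
have := size_comp_poly q1 (u%:P *: 'X + h%:P).
rewrite -QE size_affine ?polyC_eq0 // muln1 size_q1 /=.
by move: Q0; rewrite -size_poly_gt0; case: (size Q) => // m _ /= ->.
Qed.

Hypothesis cn1 : c`_n.-1 = 0.

(** The numerator of s z has degree d in y, hence denominator c, and
    c(e x + a) times the leading coefficient of this numerator is c times a
    constant: c(e x + a) and c are proportional. *)
Lemma comp_c_affine : a = 0 /\ c \Po p = e ^+ n *: c.
Proof.
have [k k0 qk] := lead_q; have [Qd _] := subst_q_top qk.
have Q0 : Q != 0 by rewrite -size_poly_eq0 size_subst_q.
have zrel := aut_z_rel.
have sz0 : s z != 0.
  apply/eqP => sz0; move: zrel; rewrite sz0 mulr0 => /esym/ev_eq0/eqP.
  by rewrite (negPf Q0).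
have sc : size c = n.-1.+2.
  by move: n_ge2; rewrite /deg; case: (size c) => [|[|]].
have [cn cn1'] := comp_affine_top e a (eq_leq sc).
have cp0 : c \Po p != 0 by rewrite comp_poly_eq0 // size_affine.
have scp : size (c \Po p) = size c.
  have := size_comp_poly c p; rewrite size_affine // muln1.
  by move: cp0 c0; rewrite -!size_poly_gt0; case: (size _) => // i;
    case: (size _) => // j _ _ /= ->.
have [l [P [lP P0 dP]]] := exact_denominator sz0.
have PQ : (c \Po p)%:P * P = c%:P ^+ l * Q.
  by apply: ev_inj; rewrite !rmorphM /= -lP -zrel mulrCA.
have sP : size P = d.+1.
  have cl : c ^+ l != 0 by rewrite expf_neq0.
  have := congr1 (fun S : {poly {poly K}} => size S) PQ.
  by rewrite -!polyC_exp !mul_polyC !size_scale // size_subst_q.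
have l1 : l = 1%N by rewrite -dP /deg sP divnn d_gt0.
have top := congr1 (fun S : {poly {poly K}} => S`_d) PQ.
rewrite l1 expr1 !coefCM Qd in top.
set t := P`_d in top; set kap := u ^+ d * k in top.
have kap0 : kap != 0 by rewrite mulf_neq0 ?expf_neq0.
have t0 : t != 0.
  by rewrite /t -[d]/((d.+1).-1) -sP -/(lead_coef P) lead_coef_eq0.
have st : size t = 1%N.
  have := congr1 (fun S : {poly K} => size S) top.
  rewrite [c * _]mulrC mul_polyC size_scale // size_mul // scp.
  move: c0 t0; rewrite -!size_poly_gt0; clear.
  by move: (size c) (size t) => i j; lia.
have [w tw] : exists w, t = w%:P.
  by exists t`_0; rewrite -size1_polyC ?st.
have w0 : w != 0 by move: t0; rewrite tw polyC_eq0.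
have topi i : (c \Po p)`_i * w = c`_i * kap.
  have := congr1 (fun S : {poly K} => S`_i) top.
  by rewrite tw !coefMC.
have n1 : n.-1.+1 = n by rewrite prednK // ltnW.
rewrite n1 in cn cn1'.
have cn_neq0 : c`_n != 0 by rewrite -/(lead_coef c) lead_coef_eq0.
have kapE : kap = e ^+ n * w.
  by apply: (mulfI cn_neq0); rewrite -topi cn mulrCA mulrA.
have a0 : a = 0.
  have := topi n.-1; rewrite cn1' cn1 mulr0 add0r mul0r => /eqP.
  rewrite !mulf_eq0 (negPf w0) (negPf cn_neq0) !orbF.
  rewrite expf_eq0 (negPf e0) andbF orbF.
  by rewrite (negPf (natK_neq0 _)) ?(ltnW n_ge2) //= => /eqP.
split=> //; apply/polyP => i; rewrite coefZ; apply: (mulIf w0).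
by rewrite topi kapE mulrCA mulrA.
Qed.

Hypothesis qd1 : q`_d.-1 = 0.

(** The combination e^n s z - u^d z cancels the leading term in y, so it is a
    polynomial r in x and y; multiply it by c. *)
Lemma q_defect : exists r : {poly {poly K}},
  Q = (u ^+ d)%:P%:P * q + c%:P * r.
Proof.
have [a_eq0 cE] := comp_c_affine.
have [k k0 qk] := lead_q; have [Qd _] := subst_q_top qk.
pose S := Q - (u ^+ d)%:P%:P * q.
have sS : (size S <= d)%N.
  apply/leq_sizeP => j; rewrite leq_eqVlt => /predU1P[<-|dj].
    by rewrite /S coefB Qd coefCM qk -polyCM subrr.
  by rewrite /S coefB coefCM !nth_default ?size_subst_q ?size_q // mulr0 subrr.
have scaleE (t : K) (f : A) : t *: f = ev t%:P%:P * f.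
  by rewrite evxyCC mulr_algl.
have zrel : ev (e ^+ n)%:P%:P * ev c%:P * s z = ev Q.
  by rewrite -rmorphM -polyCM mul_polyC -cE aut_z_rel.
have SE : ev (c%:P ^+ 1) * (e ^+ n *: s z - u ^+ d *: z) = ev S.
  have -> : ev S = ev Q - ev (u ^+ d)%:P%:P * ev q.
    by rewrite /S rmorphD rmorphN; congr (_ - _); exact: rmorphM.
  rewrite -zrel -rel expr1 (scaleE (e ^+ n)) (scaleE (u ^+ d)) mulrBr.
  by congr (_ - _); rewrite mulrCA // mulrA.
have [r rE _] := low_degree_polynomial SE sS; exists r.
have : ev (c%:P * r) = ev S by rewrite rmorphM /= -rE -SE expr1.
by move/ev_inj => ->; rewrite /S addrC subrK.
Qed.

(** Coefficient of y^(d - 1) in the previous equation: q is centered, so only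
    the contribution of h and a multiple of c remain. *)
Lemma c_dvd_h : exists g, h = c * g.
Proof.
have [r Qr] := q_defect; have [k k0 qk] := lead_q.
have [_ Qd1] := subst_q_top qk.
have k'0 : d%:R * u ^+ d.-1 * k != 0.
  by rewrite !mulf_neq0 ?expf_neq0 ?natK_neq0.
have q1d1 : q1`_d.-1 = 0 by rewrite q1E coef_map qd1 /= comp_poly0.
move: Qd1; rewrite q1d1 mulr0 add0r Qr coefD !coefCM qd1 mulr0 add0r => hr.
exists ((d%:R * u ^+ d.-1 * k)^-1 *: r`_d.-1).
by rewrite -scalerAr hr scalerA mulVf // scale1r.
Qed.

Hypothesis qx : (deg_x q < n)%N.

(** As c divides h, both sides are congruent modulo c; their coefficients have
    degree in x less than the degree of c. *)
Lemma q_quasi_homogeneous :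
  map_poly (comp_poly (e *: 'X)) q \Po (u%:P *: 'X) = (u ^+ d)%:P *: q.
Proof.
have [a_eq0 _] := comp_c_affine; have [g hg] := c_dvd_h.
have [r Qr] := q_defect.
have [W QW] := comp_congr_mod q1 (u%:P *: 'X) g%:P c%:P.
rewrite -polyCM -hg -QE in QW.
have q1E' : q1 = map_poly (comp_poly (e *: 'X)) q by rewrite q1E a_eq0 addr0.
rewrite -q1E'; apply/polyP => j; rewrite coefZ coef_scaleX.
have E : u%:P ^+ j * q1`_j - (u ^+ d)%:P * q`_j = c * (r - W)`_j.
  have := congr1 (fun S : {poly {poly K}} => S`_j) (etrans (esym QW) Qr).
  rewrite !coefD !coefCM coef_scaleX coefN.
  move: (_ * q1`_j) (_ * q`_j) (r`_j) (W`_j) => f1 f2 f3 f4 f1E.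
  by apply: (addIr (c * f4)); rewrite addrAC f1E; ring.
have qj_small : (size (q`_j)%R <= n)%N.
  apply: leq_trans (max_size_coefXY q j) _; move: qx; rewrite /deg_x; clear.
  by case: (sizeY q).
apply/eqP; rewrite -subr_eq0 E mulf_eq0 (negPf c0) /=.
apply: contraLR (_ : (size (c * (r - W)`_j)%R <= n)%N) => [rW0|].
  rewrite -ltnNge size_mul //; move: c0 rW0; rewrite /deg -!size_poly_gt0.
  by case: (size c) => // i _; case: (size _) => // i' _;
    rewrite addnS ltnS leq_addr.
rewrite -E; apply: leq_trans (size_polyD _ _) _; rewrite size_polyN geq_max.
rewrite -polyC_exp !mul_polyC !(leq_trans (size_scale_leq _ _)) //.
apply/leq_sizeP => i ni; rewrite q1E' coef_map /= coef_scaleX.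
by rewrite nth_default ?mulr0 // (leq_trans qj_small).
Qed.

End Auto.

(** * Exponentials and translations *)

(** Taylor's formula in y, applied to a numerator: its i-th term is
    D^i / i!, because D is h times the derivation in y. *)
Lemma translation_is_exp (s : algAut A) (D : {linear A -> A}) h :
  derivation D -> D x = 0 -> D y = ev h%:P ->
  s x = x -> s y = y + ev h%:P -> is_exp D s.
Proof.
move=> DM Dx Dy sx sy f k fk; have [l [P lP]] := clear_denom f.
have Dk i : (k <= i)%N -> iter i D f = 0.
  move=> ki; rewrite -(subnK ki) iterD fk; elim: (i - k)%N => // j IH.
  by rewrite iterS IH raddf0.
have sf : ev (c%:P ^+ l) * s f = evxy x (y + ev h%:P) P.
  have := congr1 s lP; rewrite rmorphM /= !lrmorph_ev sx sy => <-.
  by rewrite -polyC_exp !evxyC.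
apply: (@mul_cX_inj l); rewrite sf /evxy /eval_xy.
rewrite (@nderiv_taylor_wide _ (size P + k)); last 2 first.
- exact: mulrC.
- exact: leq_trans (size_poly _ _) (leq_addr _ _).
rewrite (big_ord_widen (size P + k) (fun i =>
  (i`!%:R^-1 : K) *: iter i D f)) ?leq_addl //.
rewrite [in RHS]big_mkcond mulr_sumr; apply: eq_bigr => i _.
rewrite nderivn_map.
rewrite -/(eval_xy _ _ _) -/(evxy x y (P^`N(i))).
have -> : (if (i < k)%N then (i`!%:R^-1 : K) *: iter i D f else 0) =
  (i`!%:R^-1 : K) *: iter i D f.
  by case: ltnP => // ki; rewrite Dk ?scaler0.
rewrite -scalerAr (iter_triangular DM Dx Dy lP) nderivn_def mulrnAr rmorphMn.
rewrite -[X in _ *: X]scaler_nat scalerA mulVf ?natK_neq0 ?fact_gt0 // scale1r.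
by rewrite rmorphM rmorphXn /= mulrC.
Qed.

(** s - 1 is locally nilpotent and acts on x, and on y modulo K[x], as the
    multiplication by e - 1 and by u - 1. *)
Lemma exp_unipotent_coord (s : algAut A) (D : {linear A -> A}) e u h :
  locally_nilpotent D -> is_exp D s ->
  s x = e *: x -> s y = u *: y + ev h%:P -> e = 1 /\ u = 1.
Proof.
move=> Dnil Ds sx sy.
have iterx k : iter k (fun b => s b - b) x = (e - 1) ^+ k *: x.
  elim: k => [|k IH]; first by rewrite scale1r.
  by rewrite iterS IH linearZ /= sx scalerA -scalerBl -[X in _ - X]mulr1
    -mulrBr -exprSr.
have s_horner p : exists r, s (ev p%:P) = ev r%:P.
  exists (p \Po (e *: 'X)).
  by rewrite evxyC lrmorph_horner sx horner_alg_scale evxyC.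
have itery k : exists r,
    iter k (fun b => s b - b) y = (u - 1) ^+ k *: y + ev r%:P.
  elim: k => [|k [r IH]]; first by exists 0; rewrite scale1r !rmorph0 addr0.
  have [r' sr] := s_horner r.
  exists ((u - 1) ^+ k *: h + r' - r).
  rewrite iterS IH raddfD /= linearZ /= sy sr.
  have -> : ev ((u - 1) ^+ k *: h + r' - r)%:P =
    (u - 1) ^+ k *: ev h%:P + ev r'%:P - ev r%:P.
    by rewrite !evxyC raddfB /= raddfD /= linearZ /= mulr_algl.
  rewrite exprSr mulrBr mulr1 scalerBl -scalerA scalerDr.
  move: (_ *: y) (_ *: ev _) (ev r'%:P) (ev r%:P) (_ *: (u *: y)) =>
    a1 a2 a3 a4 a5.
  by ring.
have scale_eq0 (t : K) : t *: x = 0 -> t = 0.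
  move=> tx; have : ev (t%:P * 'X)%:P = 0.
    by rewrite polyCM rmorphM /= evxyCC evxyCX mulr_algl.
  by move/ev_eq0/eqP; rewrite polyC_eq0 mulf_eq0 polyX_eq0 polyC_eq0 orbF =>
    /eqP.
split.
  have [k _ kx] := Dnil x; have := is_exp_unipotent Ds kx; rewrite iterx.
  by move/scale_eq0/eqP; rewrite expf_eq0 subr_eq0 => /andP[_ /eqP].
have [k _ ky] := Dnil y; have := is_exp_unipotent Ds ky; have [r ->] := itery k.
have -> : (u - 1) ^+ k *: y + ev r%:P = ev (((u - 1) ^+ k)%:P%:P * 'X + r%:P).
  by rewrite rmorphD rmorphM /= evxyCC evxyX mulr_algl.
move/ev_eq0/(congr1 (fun S : {poly {poly K}} => S`_1)).
rewrite coefD coefCM coefX coefC mulr1 addr0 coef0 => /eqP.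
by rewrite polyC_eq0 expf_eq0 subr_eq0 => /andP[_ /eqP].
Qed.

(** * The shape of automorphisms *)

Lemma aut_normal_form (s : algAut A) : reduced_form c q ->
  exists (e u : K) (g : {poly K}),
  [/\ e != 0 /\ u != 0, s x = e *: x, s y = u *: y + ev (c * g)%:P,
      c \Po (e *: 'X) = e ^+ n *: c &
      map_poly (comp_poly (e *: 'X)) q \Po (u%:P *: 'X) = (u ^+ d)%:P *: q].
Proof.
case=> -[_ _ cn1] [_ _ qd1] qx.
have [e [a [e0 sx]]] := aut_x_affine s.
have [u [h [u0 sy]]] := aut_y_affine s.
rewrite mul_polyC in sy.
pose q1 := map_poly (comp_poly (e *: 'X + a%:P)) q.
have E1 : q1 = map_poly (comp_poly (e *: 'X + a%:P)) q by [].
have [a0 cE] := comp_c_affine e0 u0 sx sy E1 erefl cn1.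
have [g hg] := c_dvd_h e0 u0 sx sy E1 erefl cn1 qd1.
have qE := q_quasi_homogeneous e0 u0 sx sy E1 erefl cn1 qd1 qx.
exists e, u, g; split=> //.
- by rewrite sx a0 addr0 -mul_polyC polyCM rmorphM /= evxyCC evxyCX mulr_algl.
- by rewrite sy hg rmorphD -mul_polyC rmorphM /= evxyCC evxyX mulr_algl.
- by move: cE; rewrite a0 addr0.
Qed.

End DanielewskiAlgebra.

(** * The surface algebra *)

Section Instance.

Variables (K : closedFieldType) (c : {poly K}) (q : {poly {poly K}}).
Hypothesis c0 : c != 0.

Local Notation A := (surface q c0).
Local Notation x := (xbar q c0).
Local Notation y := (ybar q c0).
Local Notation z := (zbar q c0).
Local Notation ev := (evxy x y).
Local Notation pi := (surface_pi q c0).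
Local Notation X0 := ('X_0 : {mpoly K[3]}).
Local Notation X1 := ('X_1 : {mpoly K[3]}).
Local Notation evm := (evxy X0 X1).

Lemma surface_rel : ev c%:P * z = ev q.
Proof. by apply/eqP; rewrite -subr_eq0 evxyC; apply/eqP; exact: surface_eq. Qed.

Lemma surface_pi_surj (a : A) : exists f, a = pi f.
Proof. by exists (repr a); rewrite -[in LHS](reprK a). Qed.

Lemma pi_evm P : pi (evm P) = ev P.
Proof. exact: lrmorph_ev. Qed.

Lemma surface_gen (a : A) :
  exists g : {poly {poly {poly K}}}, a = (map_poly ev g).[z].
Proof.
have [f ->] := surface_pi_surj a.
pose G : {poly {poly {poly K}}} -> A := fun g => (map_poly ev g).[z].
rewrite surface_piE; elim/mpolyind: f => [|k m f _ _ [g IH]].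
  by exists 0; rewrite !rmorph0 horner0.
have [t tE] : exists t, eval_xyz (Defs.coord q c0) 'X_[m] = G t.
  rewrite mpolyXE_id rmorph_prod /=.
  apply: (big_rec (fun w => exists t, w = G t)) => [|i r _ [t ->]].
    by exists 1; rewrite /G rmorph1 hornerE.
  have [s sE] : exists s, Defs.coord q c0 i = G s.
    rewrite /Defs.coord; case: i => -[|[|[|//]]] /= _.
    - by exists 'X%:P%:P; rewrite /G map_polyC hornerC /= evxyCX.
    - by exists 'X%:P; rewrite /G map_polyC hornerC /= evxyX.
    - by exists 'X; rewrite /G map_polyX hornerX.
  exists (s ^+ m i * t).
  rewrite /G [map_poly _ (_ * _)]rmorphM hornerM -!/(G _).
  rewrite /G [map_poly _ (s ^+ _)]rmorphXn horner_exp /= -!/(G _) -sE.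
  by rewrite rmorphXn /=; congr (_ ^+ _ * _); exact: eval_xyzX.
exists (k%:P%:P%:P * t + g).
rewrite !(rmorphD, rmorphM) /= hornerD hornerM map_polyC hornerC /= evxyCC.
by rewrite -[k *: _]mulr_algl rmorphM /= eval_xyz_alg tE IH.
Qed.

Lemma eval_xyz_evm (B : comAlgType K) (v : 'I_3 -> B) P :
  eval_xyz v (evm P) = evxy (v 0) (v 1) P.
Proof.
elim/poly_ind: P => [|P p IH]; first by rewrite !rmorph0.
rewrite !rmorphD !rmorphM /= !evxyX IH !evxyC eval_xyz_horner.
by congr (_ * _ + _); apply: eval_xyzX.
Qed.

(** A nonzero P takes a nonzero value at some point (a, b) with c(a) <> 0. The
    point (a, b, q(a, b) / c(a)) lies on the surface, so evaluation there
    shows that P is not a multiple of the relator. *)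
Lemma surface_ev_inj : injective ev.
Proof.
move=> P Q PQ; apply/eqP; rewrite -subr_eq0; apply/negPn/negP => PQ0.
have {PQ} : ev (P - Q) = 0 by rewrite rmorphD rmorphN /= PQ subrr.
move: (P - Q) PQ0 => {Q} {}P P0 evP0.
have [a] : exists a, ~~ root (c * lead_coef P) a.
  by apply/closed_nonrootP; rewrite mulf_neq0 // lead_coef_eq0.
rewrite rootM negb_or => /andP[ca Pa].
have [b Pb] : exists b, ~~ root (map_poly (horner_eval a) P) b.
  by apply/closed_nonrootP; rewrite -lead_coef_eq0 lead_coef_map_eq //.
have hornerE_ (t : K) (p : {poly K}) : horner_alg (t : K^o) p = p.[t].
  elim/poly_ind: p => [|p k IH]; first by rewrite rmorph0 horner0.
  by rewrite rmorphD rmorphM /= horner_algX horner_algC IH hornerMXaddC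
             -[k%:A]/(k * 1) mulr1.
have evE S : evxy (a : K^o) (b : K^o) S = (map_poly (horner_eval a) S).[b].
  by rewrite /evxy /eval_xy; congr (_.[b]); apply: eq_map_poly => p;
    exact: hornerE_.
pose v (i : 'I_3) : K^o := [:: a; b; evxy (a : K^o) (b : K^o) q / c.[a]]`_i.
have v_rel : eval_xyz v (relator c q) = 0.
  by rewrite eval_xyz_relator hornerE_ /v /= mulrC divfK // subrr.
have /asboolP[g gP] : evm P - 0 \in rel_ideal q c0.
  rewrite Quotient.idealrBE; apply/eqP.
  by have := pi_evm P; rewrite evP0 -(rmorph0 pi).
have := congr1 (eval_xyz v) gP; rewrite subr0 rmorphM /= v_rel mulr0.
by rewrite eval_xyz_evm /v /= evE => /eqP; apply/negP.
Qed.

Lemma mderivX1 (i j : 'I_3) : ('X_j : {mpoly K[3]})^`M(i) = (i == j)%:R.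
Proof.
rewrite mderivX mnmE eq_sym; case: eqP => [->|_]; last by rewrite scale0r.
by rewrite scale1r -[X in (X - _)%MM]add0m addmK mpolyX0.
Qed.

Section Flow.

Variable g : {poly K}.

(** g times the Jacobian derivation of the relator with respect to y and z,
    which therefore kills the relator. *)
Definition flow_mpoly (f : {mpoly K[3]}) : {mpoly K[3]} :=
  evm g%:P * (evm c%:P * f^`M(1) + evm q^`() * f^`M(2)).

Definition flow_fun (a : A) : A := pi (flow_mpoly (repr a)).

Lemma flow_mpolyM f h :
  flow_mpoly (f * h) = flow_mpoly f * h + f * flow_mpoly h.
Proof.
rewrite /flow_mpoly !mderivM.
by move: (evm _) (evm _) (evm _) (_^`M(_)) => *; ring.
Qed.

Lemma flow_mpolyD f h : flow_mpoly (f + h) = flow_mpoly f + flow_mpoly h.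
Proof.
rewrite /flow_mpoly !mderivD.
by move: (evm _) (evm _) (evm _) (_^`M(_)) => *; ring.
Qed.

Lemma flow_mpolyZ k f : flow_mpoly (k *: f) = k *: flow_mpoly f.
Proof. by rewrite /flow_mpoly !mderivZ -!scalerAr -scalerDr -scalerAr. Qed.

Lemma flow_relator : flow_mpoly (relator c q) = 0.
Proof.
have dM (i : 'I_3) : derivation (mderiv i : {linear {mpoly K[3]} ->
  {mpoly K[3]}}).
  by move=> f h; exact: mderivM.
have relE : relator c q = evm c%:P * 'X_2 - evm q by rewrite evxyC.
have dev i P : (evm P)^`M(i) =
  evm (derivx P) * (i == 0)%:R + evm P^`() * (i == 1)%:R.
  by have := derivation_ev X0 X1 (dM i) P; rewrite /= !mderivX1.
rewrite /flow_mpoly relE !mderivB !mderivM !dev !mderivX1 /=.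
rewrite !(mulr0, mulr1, add0r, addr0, mul0r, subr0) derivC rmorph0 mul0r sub0r.
by rewrite [_ * evm c%:P]mulrC mulrN addNr mulr0.
Qed.

Lemma flow_pi f : flow_fun (pi f) = pi (flow_mpoly f).
Proof.
rewrite /flow_fun; apply/eqP; rewrite -subr_eq0.
have /asboolP[h hE] : repr (pi f) - f \in rel_ideal q c0.
  by rewrite Quotient.idealrBE reprK.
have -> : repr (pi f) = f + h * relator c q by rewrite -hE addrC subrK.
rewrite flow_mpolyD flow_mpolyM flow_relator mulr0 addr0 rmorphD rmorphM /=.
by rewrite surface_pi_relator mulr0 addr0 subrr.
Qed.

Fact flow_zmod_morphism : zmod_morphism flow_fun.
Proof.
move=> a b; have [f ->] := surface_pi_surj a; have [h ->] := surface_pi_surj b.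
rewrite -rmorphN -rmorphD !flow_pi /= -scaleN1r flow_mpolyD flow_mpolyZ
  scaleN1r.
by rewrite rmorphD rmorphN.
Qed.

Fact flow_scalable : scalable flow_fun.
Proof.
move=> k a; have [f ->] := surface_pi_surj a.
by rewrite -linearZ !flow_pi flow_mpolyZ linearZ.
Qed.

HB.instance Definition _ := GRing.isZmodMorphism.Build A A flow_fun
  flow_zmod_morphism.
HB.instance Definition _ := GRing.isScalable.Build K A A *:%R flow_fun
  flow_scalable.

Lemma flow_derivation : derivation flow_fun.
Proof.
move=> a b; have [f ->] := surface_pi_surj a; have [h ->] := surface_pi_surj b.
by rewrite /= -rmorphM !flow_pi flow_mpolyM rmorphD !rmorphM.
Qed.

Lemma flow_x : flow_fun x = 0.
Proof. by rewrite flow_pi /flow_mpoly !mderivX1 !mulr0 addr0 mulr0 rmorph0. Qed.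

Lemma flow_y : flow_fun y = ev (c * g)%:P.
Proof.
rewrite flow_pi /flow_mpoly !mderivX1 mulr0 addr0 mulr1 -rmorphM pi_evm.
by rewrite -polyCM mulrC.
Qed.

End Flow.

Lemma surface_flow (g : {poly K}) : exists D : {linear A -> A},
  [/\ derivation D, D x = 0 & D y = ev (c * g)%:P].
Proof.
by exists (flow_fun g); split;
  [exact: flow_derivation|exact: flow_x|exact: flow_y].
Qed.

End Instance.

(** * Homomorphisms of groups *)

Section GroupHom.

Variables (G H : groupType) (f : G -> H).
Hypothesis fM : group_hom f.
Local Open Scope group_scope.

Lemma group_hom1 : f 1 = 1.
Proof. by apply: (mulgI (f 1)); rewrite -fM !mulg1. Qed.

Lemma group_homV x : f x^-1 = (f x)^-1.
Proof. by apply: (mulgI (f x)); rewrite -fM !mulgV group_hom1. Qed.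

Lemma kernel_normal : normal_subgroup (f @^-1` [set 1]).
Proof.
split; first split.
- by rewrite !inE /= group_hom1.
- move=> x y; rewrite !inE /= => fx fy.
  by rewrite fM group_homV fx fy mulgV.
- by move=> g x /= fx; rewrite /conjg !fM group_homV fx mul1g mulVg.
Qed.

Lemma range_subgroup : subgroup (range f).
Proof.
split; first by rewrite !inE /=; exists 1 => //; exact: group_hom1.
move=> x y; rewrite !inE /= => -[a _ <-] [b _ <-].
by exists (a * b^-1) => //; rewrite fM group_homV.
Qed.

End GroupHom.

(** * The exact sequence *)

Lemma horner_algZD (K : closedFieldType) (B : comAlgType K) (a : B) k p r :
  horner_alg a (k *: p + r) = k *: horner_alg a p + horner_alg a r.
Proof. by rewrite raddfD /= linearZ /= mulr_algl. Qed.

Section Assembly.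

Variables (K : closedFieldType) (c : {poly K}) (q : {poly {poly K}}).
Hypothesis c0 : c != 0.
Hypothesis charK : [pchar K] =i pred0.
Hypothesis n_ge2 : (2 <= deg c)%N.
Hypothesis q_qm : quasi_monic q.
Hypothesis d_ge2 : (2 <= deg q)%N.
Hypothesis red : reduced_form c q.

Local Notation A := (surface q c0).
Local Notation x := (xbar q c0).
Local Notation y := (ybar q c0).
Local Notation ev := (evxy x y).
Local Notation psi := (@psi K c q c0 : algAut A -> torus2 K).
Local Notation phi := (@phi K c q c0 : Gcq c q -> algAut A).

Let rel := surface_rel q c0.
Let gen := @surface_gen K c q c0.
Let ev_inj := @surface_ev_inj K c q c0.

(** The pair (e, u) is unique because x and y are algebraically independent. *)
Lemma psi_eq (s : algAut A) (eu : torus2 K) (a : K) (h : {poly K}) :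
  s x = val eu.1 *: x + a%:A -> s y = val eu.2 *: y + horner_alg x h ->
  psi s = eu.
Proof.
move=> sx sy; apply: xget_unique; first by exists a, h.
move=> [e u] [a' [h' [/=]]]; rewrite sx sy.
have evE (k : K) (p : {poly K}) : k *: y + horner_alg x p =
  ev (k%:P%:P * 'X + p%:P).
  by rewrite rmorphD rmorphM /= evxyCC evxyX evxyC mulr_algl.
have exE (k l : K) : k *: x + l%:A = ev (k *: 'X + l%:P)%:P.
  by rewrite -mul_polyC polyCD polyCM rmorphD rmorphM /= !evxyCC evxyCX
    mulr_algl.
rewrite !evE !exE => /ev_inj/polyC_inj ex /ev_inj ey.
have e1 := congr1 (fun p : {poly K} => p`_1) ex.
have e2 := congr1 (fun p : {poly {poly K}} => p`_1) ey.
rewrite !coefD !coefZ !coefX !coefC !mulr1 !addr0 in e1.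
rewrite !coefD !coefCM !coefX !coefC !mulr1 !addr0 in e2.
case: eu sx sy evE exE e1 e2 ex ey => e1 u1 /= _ _ _ _ e1E u1E _ _.
by congr (_, _); apply: val_inj; [rewrite /= e1E|apply: polyC_inj].
Qed.

Lemma psi_normal_form (s : algAut A) : exists g : {poly K},
  [/\ s x = val (psi s).1 *: x, s y = val (psi s).2 *: y + ev (c * g)%:P
    & G_cq c q (psi s)].
Proof.
have [e [u [g [[e0 u0] sx sy cE qE]]]] := aut_normal_form rel gen ev_inj
  charK c0 n_ge2 q_qm d_ge2 (@surface_flow K c q c0) s red.
pose eu : torus2 K := (Sub e e0 : Kstar K, Sub u u0 : Kstar K).
have -> : psi s = eu.
  by apply: (@psi_eq s eu 0 (c * g)); rewrite /= ?scale0r ?addr0 // sy evxyC.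
by exists g.
Qed.

Lemma psiM : group_hom psi.
Proof.
move=> s t; have [g [sx sy _]] := psi_normal_form s.
have [h [tx ty _]] := psi_normal_form t.
apply: (@psi_eq (s * t)%g _ 0
  (val (psi t).2 *: (c * g) + ((c * h) \Po (val (psi s).1 *: 'X)))).
  by rewrite scale0r addr0 /= tx linearZ /= sx scalerA mulrC.
rewrite /= ty raddfD /= linearZ /= sy scalerDr scalerA mulrC -addrA;
  congr (_ + _).
by rewrite horner_algZD !evxyC lrmorph_horner sx horner_alg_scale.
Qed.

Lemma psi_phi (g : Gcq c q) : psi (phi g) = val g.
Proof.
apply: (@psi_eq _ _ 0 0); first by rewrite scale0r addr0; exact: phi_x.
by rewrite rmorph0 addr0; exact: phi_y.
Qed.

Lemma range_psi : range psi = G_cq c q.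
Proof.
apply/seteqP; split=> [_ [s _ <-]|eu Geu].
  by have [g []] := psi_normal_form s.
have Geu' : eu \in [pred eu in G_cq c q] by exact/mem_set.
by exists (phi (Sub eu Geu')) => //; rewrite psi_phi.
Qed.

(** An element of the kernel is not only a product of exponentials, but the
    exponential of one derivation x -> 0, y -> c g. *)
Lemma ker_psi : psi @^-1` [set 1%g] = unipotent_subgroup A.
Proof.
apply/seteqP; split=> [s /= s1|]; last first.
  apply: smallest_sub; first by have [] := kernel_normal psiM.
  move=> s [D [DM Dnil Ds]] /=.
  have [g [sx sy _]] := psi_normal_form s.
  have [e1 u1] := exp_unipotent_coord ev_inj Dnil Ds sx sy.
  move: e1 u1; case: (psi s) => e u /= e1 u1.
  by congr (_, _); apply: val_inj.
apply: sub_gen_smallest.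
have [g [sx sy _]] := psi_normal_form s; rewrite s1 /= !scale1r in sx sy.
have [D [DM Dx Dy]] := surface_flow q c0 g.
exists D; split=> //.
  exact: (triangular_nilpotent rel gen ev_inj c0 n_ge2 q_qm d_ge2 DM Dx Dy).
exact: (translation_is_exp rel gen ev_inj charK c0 n_ge2 q_qm d_ge2 DM Dx Dy
  sx sy).
Qed.

End Assembly.

Theorem theorem7 (K : closedFieldType) (charK0 : [pchar K] =i pred0)
    (c : {poly K}) (q : {poly {poly K}}) (c_neq0 : c != 0)
    (n_ge2 : (2 <= deg c)%N) (q_qm : quasi_monic q) (d_ge2 : (2 <= deg q)%N)
    (red : reduced_form c q) :
  let A := surface q c_neq0 in
  let psi := @psi K c q c_neq0 : algAut A -> torus2 K in
  let phi := @phi K c q c_neq0 : Gcq c q -> algAut A in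
  [/\ range psi = G_cq c q,
      forall g : Gcq c q, psi (phi g) = val g,
      short_exact (unipotent_subgroup A) psi,
      splits psi
    & inner_semidirect (unipotent_subgroup A) (range phi)].
Proof.
move=> A psi phi.
have rangeE : range psi = G_cq c q by exact: range_psi.
have phiK g : psi (phi g) = val g by exact: psi_phi.
have psi_hom : group_hom psi by exact: psiM.
have kerE : psi @^-1` [set 1%g] = unipotent_subgroup A by exact: ker_psi.
have phi_hom : group_hom phi by exact: phi_morph.
have [kerN kerJ] := kernel_normal psi_hom; rewrite kerE in kerN kerJ.
split=> //.
- pose sec eu : algAut A :=
    if (insub eu : option (Gcq c q)) is Some g then phi g else 1%g.
  have secE eu : eu \in range psi -> exists2 g, sec eu = phi g & val g = eu.
    rewrite rangeE => Geu; rewrite /sec; case: insubP => [g _ gE|];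
      first by exists g.
    by rewrite Geu.
  exists sec; split=> [eu fv euR fvR|eu euR]; last first.
    by have [g -> gE] := secE _ euR; rewrite phiK.
  have efR : (eu * fv)%g \in range psi.
    have [a _ ae] := set_mem euR; have [b _ bf] := set_mem fvR.
    by apply/mem_set; exists (a * b)%g => //; rewrite psi_hom ae bf.
  have [g -> gE] := secE _ euR; have [h -> hE] := secE _ fvR.
  have [r -> rE] := secE _ efR.
  by rewrite -phi_hom; congr phi; apply: val_inj; rewrite rE -gE -hE.
- split=> //.
  + exact: range_subgroup.
  + apply/seteqP; split=> [s [Us [g _ gs]]|s ->].
      have : psi s = 1%g by rewrite -kerE in Us.
      rewrite -gs phiK => g1; have -> : g = 1%g by apply: val_inj.
      exact: group_hom1.
    split; first by rewrite -kerE /=; exact: group_hom1.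
    by exists 1%g => //; exact: group_hom1.
  + move=> s.
    have [g [_ _ Gs]] := psi_normal_form charK0 n_ge2 q_qm d_ge2 red s.
    pose gs : Gcq c q := Sub (psi s) (mem_set Gs).
    exists (s * (phi gs)^-1)%g.
      by rewrite -kerE /= psi_hom group_homV // phiK mulgV.
    by exists (phi gs); [exists gs|rewrite -mulgA mulVg mulg1].
Qed.
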